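(* Let $E$ be a simple finite-dimensional $\mathbf{Q}$-algebra with positive involution $*$, let $m,k\ge1$ be integers and let $f$ be an automorphism of $E^k$ commuting with the involution $*^{\times k}$ (componentwise $*$) with $f^m=1$. Assume that $Z(E)$ is contained in some CM field $K$ and that one of the following holds: (1) $m$ is odd; (2) $E\simeq\mathrm{M}_d(K)$ for some $d$; (3) $E\simeq\mathrm{M}_d(\mathbf{Q})$ for some $d$. Then $Z(E^k[m,f])$ is a product of CM fields and subfields of $K$, or, in case (3), a product of such fields and of quadratic extensions of $\mathbf{Q}$. Furthermore, in case (3), the simple factors of $E^k[m,f]$ are matrix algebras over their centers.
   Context: For a finite-dimensional $\mathbf{Q}$-algebra $R$, an integer $m\ge1$ and an automorphism $\sigma$ of $R$ with $\sigma^m=1$, $R[m,\sigma]$ denotes the $\mathbf{Q}$-algebra $\bigoplus_{i=0}^{m-1}R\,u^i$ with multiplication determined by $u^m=1$ and $ux=\sigma(x)u$ for $x\in R$. If $R$ has an involution $*$ commuting with $\sigma$, $R[m,\sigma]$ carries the induced involution $(xu^i)^*=u^{-i}x^*$. A positive involution is a $\mathbf{Q}$-linear anti-automorphism $*$ of order dividing 2 with $\operatorname{Tr}(xx^* )>0$ for $x\ne0$. A CM field is a totally imaginary quadratic extension of a totally real number field. *)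

(* Defs.v *)
From HB Require Import structures.
From mathcomp Require Import all_boot all_order all_algebra all_field.

Set Implicit Arguments.
Unset Strict Implicit.
Unset Printing Implicit Defensive.

Import Order.TTheory GRing.Theory Num.Theory.
Local Open Scope ring_scope.

Section Power.
Variables (F : fieldType) (E : falgType F).

Definition power (k : nat) := {ffun 'I_k -> E}.

HB.instance Definition _ k := GRing.PzRing.copy (power k) {ffun 'I_k -> E}.
HB.instance Definition _ k := Vector.copy (power k) {ffun 'I_k -> E}.

Variable k : nat.
Implicit Types (a : F) (x y : power k.+1).

Fact power_oner_neq0 : (1 : power k.+1) != 0.
Proof. by apply/eqP=> /ffunP/(_ ord0)/eqP; rewrite !ffunE oner_eq0. Qed.
HB.instance Definition _ :=
  GRing.PzSemiRing_isNonZero.Build (power k.+1) power_oner_neq0.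

Fact power_scalerAl a x y : a *: (x * y) = (a *: x) * y.
Proof. by apply/ffunP=> i; rewrite !ffunE scalerAl. Qed.
HB.instance Definition _ :=
  GRing.Lmodule_isLalgebra.Build F (power k.+1) power_scalerAl.

Fact power_scalerAr a x y : a *: (x * y) = x * (a *: y).
Proof. by apply/ffunP=> i; rewrite !ffunE scalerAr. Qed.
HB.instance Definition _ :=
  GRing.Lalgebra_isAlgebra.Build F (power k.+1) power_scalerAr.

HB.instance Definition _ := Algebra_isFalgebra.Build F (power k.+1).

End Power.

(* [skew_alg hs] is R[m, s]: the family x : 'I_m -> R stands for the element
   \sum_i x i * u ^+ i, so that
     (x * y) l = \sum_(i + j = l mod m) x i * s^i (y j).
   The subtraction l - i below is that of the additive group 'I_m.+1, i.e.
   it is taken modulo m.+1. *)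
Definition skew_alg (F : fieldType) (R : falgType F) (m : nat)
    (s : {lrmorphism R -> R}) of iter m s =1 id := {ffun 'I_m -> R}.

Section SkewVector.
Variables (F : fieldType) (R : falgType F) (m : nat).
Variables (s : {lrmorphism R -> R}) (hs : iter m s =1 id).
HB.instance Definition _ := Vector.copy (skew_alg hs) {ffun 'I_m -> R}.
End SkewVector.

Section Skew.
Variables (F : fieldType) (R : falgType F) (m : nat).
Variables (s : {lrmorphism R -> R}) (hs : iter m.+1 s =1 id).
Implicit Types (a : F) (x y z : skew_alg hs).

Definition skew_one : skew_alg hs := [ffun i => (i == 0)%:R].
Definition skew_mul x y : skew_alg hs :=
  [ffun l => \sum_(i < m.+1) x i * iter i s (y (l - i))].

Let itD n : {morph iter n s : x y / x + y}.
Proof. by move=> x y; elim: n => //= n ->; rewrite rmorphD. Qed.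
Let itM n : {morph iter n s : x y / x * y}.
Proof. by move=> x y; elim: n => //= n ->; rewrite rmorphM. Qed.
Let it0 n : iter n s 0 = 0.
Proof. by elim: n => //= n ->; rewrite rmorph0. Qed.
Let it1 n : iter n s 1 = 1.
Proof. by elim: n => //= n ->; rewrite rmorph1. Qed.
Let itZ n a (r : R) : iter n s (a *: r) = a *: iter n s r.
Proof. by elim: n => //= n ->; rewrite linearZ. Qed.
Let it_sum n (f : 'I_m.+1 -> R) :
  iter n s (\sum_i f i) = \sum_i iter n s (f i).
Proof. exact: (big_morph _ (itD n) (it0 n)). Qed.
Let it_mod n (r : R) : iter (n %% m.+1) s r = iter n s r.
Proof.
rewrite [in RHS](divn_eq n m.+1) addnC iterD; congr iter.
by elim: (n %/ m.+1)%N => // q IH; rewrite mulSn iterD -IH hs.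
Qed.
Let it_add (i j : 'I_m.+1) (r : R) : iter i s (iter j s r) = iter (i + j)%R s r.
Proof. by rewrite -iterD -it_mod. Qed.

Fact skew_mulA : associative skew_mul.
Proof.
move=> x y z; apply/ffunP=> l; rewrite !ffunE.
under eq_bigr => i _.
  rewrite ffunE it_sum mulr_sumr (reindex_inj (addIr (- i))).
  under eq_bigr => j _ do
    rewrite itM it_add [i + _]addrC subrK opprB addrA subrK mulrA.
  over.
by rewrite exchange_big; apply: eq_bigr => j _; rewrite ffunE mulr_suml.
Qed.

Fact skew_mul1l : left_id skew_one skew_mul.
Proof.
move=> x; apply/ffunP=> l; rewrite ffunE (bigD1 0) //= big1 ?addr0.
  by rewrite ffunE eqxx mul1r subr0.
by move=> i /negPf i_neq0; rewrite ffunE i_neq0 mul0r.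
Qed.

Fact skew_mul1r : right_id skew_one skew_mul.
Proof.
move=> x; apply/ffunP=> l; rewrite ffunE (bigD1 l) //= big1 ?addr0.
  by rewrite ffunE subrr eqxx it1 mulr1.
by move=> i /negPf il; rewrite ffunE subr_eq0 eq_sym il it0 mulr0.
Qed.

Fact skew_mulDl : left_distributive skew_mul +%R.
Proof.
move=> x y z; apply/ffunP=> l; rewrite !ffunE -big_split /=.
by apply: eq_bigr => i _; rewrite ffunE mulrDl.
Qed.

Fact skew_mulDr : right_distributive skew_mul +%R.
Proof.
move=> x y z; apply/ffunP=> l; rewrite !ffunE -big_split /=.
by apply: eq_bigr => i _; rewrite ffunE itD mulrDr.
Qed.

Fact skew_oner_neq0 : skew_one != 0.
Proof. by apply/eqP=> /ffunP/(_ 0)/eqP; rewrite !ffunE eqxx oner_eq0. Qed.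

HB.instance Definition _ := GRing.Zmodule_isNzRing.Build (skew_alg hs)
  skew_mulA skew_mul1l skew_mul1r skew_mulDl skew_mulDr skew_oner_neq0.

Fact skew_scalerAl a x y : a *: (x * y) = (a *: x) * y.
Proof.
apply/ffunP=> l; rewrite !ffunE scaler_sumr.
by apply: eq_bigr => i _; rewrite ffunE scalerAl.
Qed.
HB.instance Definition _ :=
  GRing.Lmodule_isLalgebra.Build F (skew_alg hs) skew_scalerAl.

Fact skew_scalerAr a x y : a *: (x * y) = x * (a *: y).
Proof.
apply/ffunP=> l; rewrite !ffunE scaler_sumr.
by apply: eq_bigr => i _; rewrite ffunE itZ scalerAr.
Qed.
HB.instance Definition _ :=
  GRing.Lalgebra_isAlgebra.Build F (skew_alg hs) skew_scalerAr.

HB.instance Definition _ := Algebra_isFalgebra.Build F (skew_alg hs).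

(* The presentation of R[m, s] by R and u; 1 is taken in Z/m, so that u = 1
   when m = 1. *)
Definition skewC (r : R) : skew_alg hs := [ffun i => r *+ (i == 0)].
Definition skewU : skew_alg hs := [ffun i => (i == inord (1 %% m.+1))%:R].

Fact skewCM r r' : skewC (r * r') = skewC r * skewC r'.
Proof.
apply/ffunP=> l; rewrite !ffunE (bigD1 0) //= big1 ?addr0.
  by rewrite !ffunE eqxx subr0 mulr1n -mulrnAr.
by move=> i /negPf i0; rewrite !ffunE i0 mulr0n mul0r.
Qed.

Fact skewUX n : skewU ^+ n = [ffun i => (i == inord (n %% m.+1))%:R] :> skew_alg hs.
Proof.
elim: n => [|n IH].
  apply/ffunP=> l; rewrite !ffunE mod0n; congr (_ == _)%:R.
  by apply/val_inj; rewrite /= inordK.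
apply/ffunP=> l; rewrite exprS IH ffunE (bigD1 (inord (1 %% m.+1))) //=.
rewrite big1 ?addr0 => [|i /negPf i1]; last by rewrite ffunE i1 mul0r.
rewrite !ffunE eqxx mul1r subr_eq.
have ->: inord (n %% m.+1) + inord (1 %% m.+1) = inord (n.+1 %% m.+1) :> 'I_m.+1.
  by apply/val_inj; rewrite /= !inordK ?ltn_mod // modnDm addn1.
by case: eqP => _; rewrite ?it1 ?it0.
Qed.

Fact skewUm : skewU ^+ m.+1 = 1 :> skew_alg hs.
Proof. by rewrite -[RHS](expr0 skewU) !skewUX modnn mod0n. Qed.

Fact skewCUE r n (i : 'I_m.+1) :
  (skewC r * skewU ^+ n : skew_alg hs) i = r *+ (i == inord (n %% m.+1)).
Proof.
rewrite skewUX ffunE (bigD1 0) //= big1 ?addr0.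
  by rewrite !ffunE eqxx subr0 mulr1n mulr_natr.
by move=> j /negPf j0; rewrite !ffunE j0 mul0r.
Qed.

Fact skewU_comm r : skewU * skewC r = skewC (s r) * skewU.
Proof.
apply/ffunP=> l; rewrite -[skewU in RHS]expr1 skewCUE.
rewrite ffunE (bigD1 (inord (1 %% m.+1))) //= big1 ?addr0; last first.
  by move=> i /negPf i1; rewrite !ffunE i1 mul0r.
rewrite !ffunE eqxx mul1r subr_eq0 inordK ?ltn_mod // it_mod /=.
by case: eqP; rewrite ?mulr1n ?mulr0n ?rmorph0.
Qed.

Fact skew_sumE x : x = \sum_(i < m.+1) skewC (x i) * skewU ^+ i.
Proof.
apply/ffunP=> l; rewrite sum_ffunE (bigD1 l) //= big1 ?addr0.
  by rewrite skewCUE modn_small // inord_val eqxx.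
by move=> i /negPf il; rewrite skewCUE modn_small // inord_val eq_sym il.
Qed.

End Skew.

Section Notions.
Variable F : fieldType.

Definition is_ideal (A : falgType F) (I : {vspace A}) : Prop :=
  ({:A} * I <= I)%VS /\ (I * {:A} <= I)%VS.

(* An falgType is never the zero ring. *)
Definition simple_alg (A : falgType F) : Prop :=
  forall I : {vspace A}, is_ideal I -> I = 0%VS \/ I = fullv.

(* The unit of B : {aspace A} need not be 1, but it is central in A when B is
   an ideal, so that such a B is a direct factor of the algebra A. *)
Definition simple_factor (A : falgType F) (B : {aspace A}) : Prop :=
  is_ideal B /\ simple_alg (subvs_of B).

Definition product_of_simple_factors (A : falgType F) : Prop :=
  exists (n : nat) (B : 'I_n -> {aspace A}),
    [/\ forall i, simple_factor (B i),
        directv (\sum_i B i)%VS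
      & (\sum_i B i)%VS = fullv].

Definition center_alg (A : falgType F) : falgType F :=
  subvs_of 'Z({:A})%AS.

Definition matrix_alg_over_center (A : falgType F) : Prop :=
  exists (d : nat) (phi : {rmorphism A -> 'M[center_alg A]_d}),
    bijective phi /\ forall z : center_alg A, phi (vsval z) = z%:M.

(* Trace of the left multiplication by x. *)
Definition alg_trace (A : falgType F) (x : A) : F :=
  \sum_i coord (vbasis {:A}) i (x * (vbasis {:A})`_i).

(* The isomorphism is given by its components pi i : A -> L i. *)
Definition product_of_fields (P : fieldExtType F -> Prop) (A : falgType F) :
    Prop :=
  exists (n : nat) (L : 'I_n -> fieldExtType F)
         (pi : forall i, {rmorphism A -> L i}),
    (forall i, P (L i)) /\
    (forall y : (forall i, L i), exists! z, forall i, pi i z = y i).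

End Notions.

Definition positive_involution (A : falgType rat) (star : {linear A -> A}) :
    Prop :=
  [/\ forall x y, star (x * y) = star y * star x,
      involutive star
    & forall x, x != 0 -> 0 < alg_trace (x * star x)].

(* The image of an embedding of a number field in the complex numbers lies in
   the field algC of algebraic complex numbers. *)
Definition totally_real (L : fieldExtType rat) : Prop :=
  forall (tau : {rmorphism L -> algC}) (x : L), tau x \is Num.real.

Definition totally_imaginary (L : fieldExtType rat) : Prop :=
  forall tau : {rmorphism L -> algC}, exists x : L, tau x \isn't Num.real.

Definition CM_field (L : fieldExtType rat) : Prop :=
  totally_imaginary L /\
  exists L0 : {subfield L},
    totally_real (subvs_of L0) /\ \dim_L0 {:L} = 2%N.

Definition subfield_of (K L : fieldExtType rat) : Prop :=
  exists _ : {rmorphism L -> K}, True.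

Definition quadratic_field (L : fieldExtType rat) : Prop := \dim {:L} = 2%N.

Definition is_matrix_alg (A : falgType rat) (L : fieldType) : Prop :=
  exists (d : nat) (phi : {rmorphism A -> 'M[L]_d}), bijective phi.

Definition powmap (E : falgType rat) (k : nat) (star : E -> E)
  (x : power E k) : power E k := [ffun i => star (x i)].

(* Main.v *)
Require Import Defs.
From HB Require Import structures.
From mathcomp Require Import all_boot all_order all_algebra all_field.
From mathcomp Require Import ring.
From Stdlib Require Import Classical.

(* The algebra A = E^k[m, f] carries a positive trace form, so that I + I^perp = A
   for every ideal I; hence A is a product of simple factors and its center Z is
   a product of number fields L, each stable under the involution.  Positivity
   forces every complex embedding of L to turn the involution into complex
   conjugation, so L is CM as soon as the involution is nontrivial on L.

   Suppose it is trivial on L.  Some field M contains both L and, through one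
   coordinate j, the center F of E.  The center Z is spanned by its homogeneous
   elements z = x u^i, and z z^* = x x^* shows that in M the square of z is
   the element c = x_j x_j^* of F.
   - If m is odd, then z^m is also in F, so z is in F and L embeds in F.
   - If E = M_d(K), then L fixed by the involution forces some power of f to
     induce complex conjugation on F = K (Dedekind), and x_j conjugates an even
     power f^(2p) of f on the j-th copy of E.  By Skolem-Noether, applied to
     f^p or to the anti-automorphism f^p o *, c is a square in K, and again L
     embeds in F.
   - If E = M_d(Q), then L is spanned over Q by the powers of one homogeneous
     element w of least degree, and w^2 is rational.  Moreover, for a rank one
     idempotent p of one copy of E, p A p is contained in p Z, which splits the
     simple factors of A. *)

Set Implicit Arguments.
Unset Strict Implicit.
Unset Printing Implicit Defensive.

Import Order.TTheory GRing.Theory Num.Theory.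
Local Open Scope ring_scope.

(** * Semisimplicity from a positive trace form *)

(** The field L comes from the center of A and F from the center of E^k, and in general neither
    center contains the other. Both lie in the center of the centralizer of E^k in A, which is
    commutative and stable under the involution, hence again a product of fields; M is one of its
    factors, chosen so that the unit of L and one coordinate idempotent map to 1. Because the
    involution is trivial on L, z and its star have the same image in M; this is why their product
    computes the square of z, and the problem becomes that of finding a square root inside F.
    Dedekind's lemma enters through orbit sums: for c in F the sum of the f^i(c) is central in A, so
    it and its star have the same image in M. This equality between sums of characters of F forces
    star to occur among the powers of f acting on F. For the splitting, the obstacle is to build
    central elements of a prescribed degree. The element that conjugates the j-th copy is chosen
    fixed by the whole stabiliser of j, so that summing its translates under f multiplies it by a
    positive integer instead of cancelling it. *)

Definition pos_trace (A : falgType rat) (st : {linear A -> A})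
    (T : {scalar A}) : Prop :=
  [/\ forall x y, st (x * y) = st y * st x,
      involutive st,
      forall x y, T (x * y) = T (y * x),
      forall x, T (st x) = T x
    & forall x, x != 0 -> 0 < T (x * st x)].

Lemma is_idealP (F : fieldType) (A : falgType F) (I : {vspace A}) :
  is_ideal I <-> forall a x, x \in I -> a * x \in I /\ x * a \in I.
Proof.
split=> [[/prodvP l /prodvP r] a x xI | h].
  by split; [apply: l | apply: r]; rewrite ?memvf.
by split; apply/prodvP; [move=> a x _ xI | move=> x a xI _]; case: (h a x xI).
Qed.

Definition central (R : pzRingType) (c : R) := forall a, c * a = a * c.

Section Central.
Variable R : pzRingType.
Lemma central0 : central (0 : R). Proof. by move=> a; rewrite mul0r mulr0. Qed.
Lemma central1 : central (1 : R). Proof. by move=> a; rewrite mul1r mulr1. Qed.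
Lemma centralD (c d : R) : central c -> central d -> central (c + d).
Proof. by move=> cC dC a; rewrite mulrDl mulrDr cC dC. Qed.
Lemma centralN (c : R) : central c -> central (- c).
Proof. by move=> cC a; rewrite mulNr mulrN cC. Qed.
Lemma centralM (c d : R) : central c -> central d -> central (c * d).
Proof. by move=> cC dC a; rewrite -mulrA dC mulrA cC -mulrA. Qed.
Lemma centralX (c : R) n : central c -> central (c ^+ n).
Proof.
move=> cC; elim: n => [|n IH]; first by rewrite expr0; apply: central1.
by rewrite exprS; apply: centralM.
Qed.
Lemma central_sum I (r : seq I) (P : pred I) (F : I -> R) :
  (forall i, P i -> central (F i)) -> central (\sum_(i <- r | P i) F i).
Proof. by move=> FC; apply: big_ind => //; [apply: central0 | apply: centralD]. Qed.
End Central.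

Lemma vsval1 (F : fieldType) (A : falgType F) (B : {aspace A}) :
  1 \in B -> vsval (1 : subvs_of B) = 1.
Proof. by move=> B1; apply/eqP; rewrite algid_eq1. Qed.

Lemma mem_center (F : fieldType) (A : falgType F) (z : A) :
  reflect (central z) (z \in 'Z({:A})%AS).
Proof.
rewrite memv_cap memvf /=; apply: (iffP idP) => [/centvP zC a | zC].
  by apply: zC; rewrite memvf.
by apply/centvP=> a _.
Qed.

Section Perp.
Variables (A : falgType rat) (st : {linear A -> A}) (T : {scalar A}).
Hypothesis posT : pos_trace st T.

Lemma pos_trace_anti x y : st (x * y) = st y * st x.
Proof. by case: posT => h. Qed.
Lemma pos_trace_stK : involutive st.
Proof. by case: posT. Qed.
Lemma pos_traceC x y : T (x * y) = T (y * x).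
Proof. by case: posT. Qed.
Lemma pos_trace_st x : T (st x) = T x.
Proof. by case: posT. Qed.
Lemma pos_trace_gt0 x : x != 0 -> 0 < T (x * st x).
Proof. by case: posT => _ _ _ _; apply. Qed.
Lemma pos_trace_eq0 x : T (x * st x) = 0 -> x = 0.
Proof.
by move=> h; apply/eqP/contraT => /pos_trace_gt0; rewrite h ltxx.
Qed.
Lemma pos_trace_st1 : st 1 = 1.
Proof. by rewrite -[LHS]mulr1 -{2}[1]pos_trace_stK -pos_trace_anti mulr1
  pos_trace_stK. Qed.

(** Pairing against a basis of I presents the orthogonal of I as a kernel, so its codimension is at
    most dim I by rank-nullity; positivity, giving a trivial intersection, then yields a
    complement. *)
Definition perp_map (I : {vspace A}) (x : A) : {ffun 'I_(\dim I) -> rat^o} :=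
  [ffun i : 'I_(\dim I) => T (x * st (vbasis I)`_i)].

Fact perp_map_is_linear I : linear (perp_map I).
Proof.
by move=> a x y; apply/ffunP=> i; rewrite !ffunE mulrDl -scalerAl linearP.
Qed.
HB.instance Definition _ I :=
  GRing.isLinear.Build rat A {ffun 'I_(\dim I) -> rat^o} _ (perp_map I)
    (perp_map_is_linear I).

Definition perp (I : {vspace A}) : {vspace A} := lker (linfun (perp_map I)).

Lemma perpP (I : {vspace A}) x : reflect (forall y, y \in I -> T (x * st y) = 0) (x
  \in perp I).
Proof.
rewrite memv_ker lfunE /=; apply: (iffP eqP) => [h y /coord_vbasis-> | h].
  rewrite linear_sum mulr_sumr linear_sum big1 // => i _.
  rewrite linearZ -scalerAr linearZ /=.
  by move/ffunP/(_ i): h; rewrite !ffunE => ->; rewrite mulr0.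
by apply/ffunP=> i; rewrite !ffunE h // vbasis_mem // memt_nth.
Qed.

Lemma perp_cap I : (I :&: perp I = 0)%VS.
Proof.
apply/eqP; rewrite -subv0; apply/subvP=> x /[!memv_cap] /andP[xI /perpP/(_ x xI)].
by rewrite memv0 => /pos_trace_eq0 ->.
Qed.

Lemma perp_add I : (I + perp I = fullv)%VS.
Proof.
apply/eqP; rewrite eqEdim subvf /= dimv_disjoint_sum ?perp_cap //.
have := limg_ker_dim (linfun (perp_map I)) fullv; rewrite capfv -/(perp I) => <-.
rewrite [leqRHS]addnC leq_add2l.
by rewrite (leq_trans (dimvS (subvf _))) // dimvf /dim /= card_ord muln1.
Qed.

(** For the form [T (x * st y)], multiplication by a has adjoint multiplication by [st a]: directly
    on the right, and through T(xy) = T(yx) on the left. Hence I itself does not have to be stable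
    under [st]. *)
Lemma perp_ideal I : is_ideal I -> is_ideal (perp I).
Proof.
move/is_idealP=> idI; apply/is_idealP=> a x /perpP h.
split; apply/perpP=> y yI.
  rewrite -mulrA pos_traceC -mulrA -[a]pos_trace_stK -pos_trace_anti.
  by apply: h; case: (idI (st a) y yI).
rewrite -mulrA -[a]pos_trace_stK -pos_trace_anti.
by apply: h; case: (idI (st a) y yI).
Qed.

(** The unit is the component in I of 1 = e + e'. The component e' kills I, since products of I with
    its orthogonal lie in both ideals. *)
Lemma ideal_unit (I : {vspace A}) : is_ideal I -> exists e, e \in I /\
  forall x, x \in I -> x * e = x /\ e * x = x.
Proof.
move=> idI; have: 1 \in (I + perp I)%VS by rewrite perp_add memvf.
case/memv_addP=> e eI [e' e'I def1]; exists e; split=> // x xI.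
have /is_idealP idP := perp_ideal idI; move/is_idealP: idI => idI.
have z0 y : y \in I -> y \in perp I -> y = 0.
  by move=> yI yP; apply/eqP; rewrite -memv0 -(perp_cap I) memv_cap yI.
have xe' : x * e' = 0 by apply: z0; [case: (idI e' x xI) | case: (idP x e' e'I)].
have e'x : e' * x = 0 by apply: z0; [case: (idI e' x xI) | case: (idP x e' e'I)].
by split; [rewrite -[RHS]mulr1 | rewrite -[RHS]mul1r];
  rewrite def1 ?mulrDr ?mulrDl ?xe' ?e'x addr0.
Qed.

Lemma minimal_ideal (I : {vspace A}) : is_ideal I -> I != 0%VS ->
  exists2 J : {vspace A}, [/\ is_ideal J, J != 0%VS & (J <= I)%VS]
    & forall J', is_ideal J' -> (J' <= J)%VS -> J' = 0%VS \/ J' = J.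
Proof.
move: {2}(\dim I) (leqnn (\dim I)) => n.
elim: n I => [|n IH] I leI idI I0.
  by move: leI; rewrite leqn0 dimv_eq0 (negPf I0).
case: (classic (exists J, [/\ is_ideal J, J != 0%VS, (J <= I)%VS & J != I])).
  case=> J [idJ J0 sJI neJI].
  have [|J' [idJ' J'0 sJ'] minJ'] := IH J _ idJ J0.
    rewrite -ltnS; apply: leq_trans leI; rewrite ltn_neqAle dimvS // andbT.
    by apply: contraNneq neJI => eqd; rewrite eqEdim sJI eqd /=.
  by exists J' => //; split=> //; apply: subv_trans sJI.
move=> noJ; exists I => // J' idJ' sJ'.
have [->|J'0] := eqVneq J' 0%VS; first by left.
by right; apply/eqP/contraT=> ne; case: noJ; exists J'.
Qed.

Lemma minimal_ideal_factor (J : {vspace A}) : is_ideal J -> J != 0%VS ->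
  (forall J', is_ideal J' -> (J' <= J)%VS -> J' = 0%VS \/ J' = J) ->
  exists2 B : {aspace A}, B = J :> {vspace A} & simple_factor B.
Proof.
move=> idJ J0 minJ.
have [e [eJ eU]] := ideal_unit idJ.
have algJ : is_aspace J.
  apply/andP; split; last first.
    by apply/prodvP=> x y xJ yJ; move/is_idealP: idJ => /(_ x y yJ)[].
  apply/has_algidP; exists e; split=> //.
    apply: contraNneq J0 => e0; rewrite -subv0; apply/subvP=> x xJ.
    by case: (eU x xJ); rewrite e0 mulr0 => <-; rewrite mem0v.
  by move=> x /eU[].
exists (ASpace algJ) => //; split=> // I /is_idealP idI.
(* An ideal of the algebra J is an ideal of A: for y in J, a y = (a e) y with a e in J, and
   similarly on the right. *)
have idI' : is_ideal (linfun (@vsval _ _ (ASpace algJ)) @: I)%VS.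
  apply/is_idealP=> a x /memv_imgP[y yI ->]; rewrite lfunE /=.
  have [yJ1 yJ2] := eU _ (subvsP y).
  have aeJ : a * e \in ASpace algJ by move/is_idealP: idJ => /(_ a e eJ)[].
  have eaJ : e * a \in ASpace algJ by move/is_idealP: idJ => /(_ a e eJ)[].
  split; apply/memv_imgP.
    exists (Subvs aeJ * y); first by case: (idI (Subvs aeJ) y yI).
    by rewrite lfunE /= -mulrA yJ2.
  exists (y * Subvs eaJ); first by case: (idI (Subvs eaJ) y yI).
  by rewrite lfunE /= mulrA yJ1.
case: (minJ _ idI') => [|h|h].
- by apply/subvP=> x /memv_imgP[y _ ->]; rewrite lfunE /= (subvsP y).
- left; apply/eqP; rewrite -subv0; apply/subvP=> x xI.
  have := memv_img (linfun (@vsval _ _ (ASpace algJ))) xI.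
  by rewrite h !memv0 lfunE.
right; apply/eqP; rewrite eqEsubv subvf; apply/subvP=> x _.
have: vsval x \in (linfun (@vsval _ _ (ASpace algJ)) @: I)%VS.
  by rewrite h; apply: (subvsP x).
by case/memv_imgP=> y yI; rewrite lfunE /= => /val_inj ->.
Qed.

(** Induction on the dimension: a minimal ideal J splits off with complement the intersection of I
    with the orthogonal of J. The sum of dimensions is carried along because it encodes
    directness. *)
Lemma ideal_decomposition n (I : {vspace A}) : (\dim I <= n)%N -> is_ideal I ->
  exists (n : nat) (B : 'I_n -> {aspace A}),
    [/\ forall i, simple_factor (B i), (\sum_i B i)%VS = I
      & (\sum_i \dim (B i))%N = \dim I].
Proof.
elim: n I => [|n IH] I leI idI.
  exists 0, (fun _ => aspacef A); split=> [[]//||]; rewrite big_ord0.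
    by apply/esym/eqP; rewrite -dimv_eq0 -leqn0.
  by apply/esym/eqP; rewrite -leqn0.
have [I0|I0] := eqVneq I 0%VS.
  by apply: IH idI; rewrite I0 dimv0.
have [J [idJ J0 sJI] minJ] := minimal_ideal idI I0.
have [B defB sB] := minimal_ideal_factor idJ J0 minJ.
have idK : is_ideal (I :&: perp J)%VS.
  apply/is_idealP=> a x /[!memv_cap] /andP[xI xP].
  have /is_idealP/(_ a x xP)[-> ->] := perp_ideal idJ.
  by move/is_idealP: idI => /(_ a x xI)[-> ->].
have cJK : (J :&: (I :&: perp J) = 0)%VS.
  by apply/eqP; rewrite -subv0 -(perp_cap J) capvS // capvSr.
have sumJK : (J + (I :&: perp J) = I)%VS.
  by rewrite capvC vspace_modl // perp_add capfv.
have dJK : (\dim J + \dim (I :&: perp J) = \dim I)%N.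
  by rewrite -dimv_disjoint_sum // sumJK.
have [||n' [B' [sB' sumB' dimB']]] := IH (I :&: perp J)%VS => //.
  by rewrite -ltnS (leq_trans _ leI) // -dJK -add1n leq_add2r lt0n dimv_eq0.
exists n'.+1, (fun i => if unlift ord0 i is Some j then B' j else B).
rewrite !big_ord_recl unlift_none defB.
split=> [i||]; first by case: unliftP.
  by under eq_bigr do rewrite liftK; rewrite sumB' sumJK.
by under eq_bigr do rewrite liftK; rewrite dimB' dJK.
Qed.

Lemma pos_trace_product : product_of_simple_factors A.
Proof.
have [|n [B [sB sumB dimB]]] := @ideal_decomposition _ fullv (leqnn _).
  by apply/is_idealP=> a x _; rewrite !memvf.
by exists n, B; split=> //; rewrite directvE /= sumB dimB.
Qed.

End Perp.

(** As c is central, c A is a two-sided ideal; it contains c, so it is everything and contains 1. *)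
Lemma simple_central_inv (F : fieldType) (A : falgType F) (c : A) :
  simple_alg A -> central c -> c != 0 -> exists c', c * c' = 1.
Proof.
move=> simA cC c0.
have idI : is_ideal (limg (amull c)).
  apply/is_idealP=> a x /memv_imgP[y _ ->]; rewrite !lfunE /=.
  split; apply/memv_imgP; [exists (a * y) | exists (y * a)];
    rewrite ?memvf //= lfunE /=.
    by rewrite mulrA -cC mulrA.
  by rewrite mulrA.
case: (simA _ idI) => [I0 | If].
  have: amull c 1 \in limg (amull c) by rewrite memv_img ?memvf.
  by rewrite I0 memv0 lfunE /= mulr1 (negPf c0).
have: 1 \in limg (amull c) by rewrite If memvf.
by case/memv_imgP=> c' _; rewrite lfunE /= => ->; exists c'.
Qed.

Lemma simple_comm_fieldExt (F : fieldType) (A : falgType F) :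
  simple_alg A -> commutative (@GRing.mul A) ->
  exists (L : fieldExtType F) (g : {lrmorphism A -> L}) (h : {lrmorphism L -> A}),
    cancel g h /\ cancel h g.
Proof.
move=> simA comA.
pose cM := GRing.PzRing_hasCommutativeMul.Build A comA.
pose cA : comUnitRingType := HB.pack (A : Type) (Falgebra.on A) cM.
have fM : GRing.ComUnitRing_isField cA.
  constructor=> x x0; apply/unitrP.
  have [y xy] := simple_central_inv simA (comA x) x0.
  by exists y; split=> //; rewrite -[RHS]xy; apply: comA.
pose L : fieldExtType F := HB.pack (A : Type) (Falgebra.on A) cM fM.
pose g : {lrmorphism A -> L} := GRing.LRMorphism.clone _ _ _ _ (@idfun A) _.
pose h : {lrmorphism L -> A} := GRing.LRMorphism.clone _ _ _ _ (@idfun A) _.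
by exists L, g, h.
Qed.

(** [pi] is multiplication by the unit of B. The section [io] is only linear because it sends 1 to
    the idempotent [algid B]. *)
Lemma simple_factor_field (Z : falgType rat) (B : {aspace Z}) :
  commutative (@GRing.mul Z) -> simple_factor B ->
  exists (L : fieldExtType rat) (pi : {lrmorphism Z -> L}) (io : {linear L -> Z}),
    cancel io pi /\ forall z, io (pi z) = z * algid B.
Proof.
move=> comZ [/is_idealP idB simB].
have comB : commutative (@GRing.mul (subvs_of B)).
  by move=> x y; apply: val_inj; apply: comZ.
have [L [g [h [gK hK]]]] := simple_comm_fieldExt simB comB.
pose p z := vsproj B (z * algid B).
have pE z : vsval (p z) = z * algid B.
  by rewrite vsprojK //; case: (idB z (algid B) (memv_algid B)).
have pl : linear (g \o p).
  move=> a x y /=; rewrite -linearP; congr (g _); apply: val_inj.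
  by rewrite /= !pE mulrDl scalerAl.
have pm : monoid_morphism (g \o p).
  split=> [|x y] /=.
    by rewrite -(rmorph1 g); congr (g _); apply: val_inj; rewrite /= pE mul1r.
  rewrite -rmorphM; congr (g _); apply: val_inj; rewrite /= !pE.
  by rewrite -!mulrA [algid B * _]comZ -mulrA (algidl (memv_algid B)).
have io_l : linear (vsval \o h) by move=> a x y; rewrite /= !linearP.
pose plM := GRing.isLinear.Build _ _ _ _ (g \o p) pl.
pose pmM := GRing.isMonoidMorphism.Build _ _ (g \o p) pm.
pose iM := GRing.isLinear.Build _ _ _ _ (vsval \o h) io_l.
pose pi : {lrmorphism Z -> L} := HB.pack (g \o p) plM pmM.
pose io : {linear L -> Z} := HB.pack (vsval \o h) iM.
exists L, pi, io; split=> [y | z]; last by rewrite /= gK pE.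
rewrite /= -[RHS]hK; congr (g _); apply: val_inj.
by rewrite /= pE (algidr (subvsP _)).
Qed.

Lemma comm_pos_fields (Z : falgType rat) (st : {linear Z -> Z}) (T : {scalar Z}) :
  pos_trace st T -> commutative (@GRing.mul Z) ->
  exists (n : nat) (L : 'I_n -> fieldExtType rat)
         (pi : forall i, {lrmorphism Z -> L i}) (io : forall i, {linear L i -> Z}),
    [/\ forall i, cancel (io i) (pi i),
        forall i j y, j != i -> pi j (io i y) = 0
      & forall z, \sum_i io i (pi i z) = z].
Proof.
move=> posT comZ.
have [n [B [sB dB fB]]] := pos_trace_product posT.
have [L /fin_all_exists [pi /fin_all_exists [io piP]]] :=
  fin_all_exists (fun i => simple_factor_field comZ (sB i)).
exists n, L, pi, io.
(* The product of two distinct units lies in B j and in the sum of the other factors, an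
   intersection that directness makes zero. *)
have e0 i j : j != i -> algid (B i) * algid (B j) = 0.
  move=> ji; apply/eqP; rewrite -memv0.
  have /directv_sumP/(_ j isT) <- := dB.
  have [/is_idealP idi _] := sB i; have [/is_idealP idj _] := sB j.
  rewrite memv_cap; apply/andP; split.
    by case: (idj (algid (B i)) _ (memv_algid (B j))).
  rewrite (subvP (sumv_sup i _ (subvv _))) 1?eq_sym //.
  by case: (idi (algid (B j)) _ (memv_algid (B i))).
split=> [i | i j y ji | z]; first by case: (piP i).
  have [ioK ioE] := piP i; have [jK jE] := piP j.
  rewrite -[pi j _]jK jE -[io i y](congr1 (io i) (ioK y)) ioE -mulrA e0 //.
  by rewrite mulr0 linear0.
under eq_bigr => i _ do rewrite (piP i).2.
rewrite -mulr_sumr -[RHS]mulr1; congr (_ * _).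
(* The units add up to 1, since the component of 1 in each B i has to be its unit. *)
have: 1 \in (\sum_i B i)%VS by rewrite fB memvf.
case/memv_sumP=> b bB b1; rewrite [RHS]b1; apply: eq_bigr => i _.
rewrite -[LHS]mulr1 b1 mulr_sumr (bigD1 i) //= (algidl (bB i isT)) big1 ?addr0 //.
move=> j ji; rewrite -[b j](algidl (bB j isT)) mulrA e0 // mul0r //.
Qed.

(** * The involution induced on each field factor *)

Section Factors.
Variables (Z : falgType rat) (st : {linear Z -> Z}) (T : {scalar Z}).
Hypotheses (posT : pos_trace st T) (comZ : commutative (@GRing.mul Z)).
Variables (n : nat) (L : 'I_n -> fieldExtType rat).
Variables (pi : forall i, {lrmorphism Z -> L i}) (io : forall i, {linear L i -> Z}).
Hypotheses (ioK : forall i, cancel (io i) (pi i))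
  (pi_io : forall i j y, j != i -> pi j (io i y) = 0)
  (sum_io : forall z, \sum_i io i (pi i z) = z).

Lemma factors_inj z : (forall i, pi i z = 0) -> z = 0.
Proof. by move=> h; rewrite -[z]sum_io big1 // => i _; rewrite h linear0. Qed.

Lemma factors_eq z z' : (forall i, pi i z = pi i z') -> z = z'.
Proof.
move=> h; apply/eqP; rewrite -subr_eq0; apply/eqP/factors_inj=> i.
by rewrite rmorphB /= h subrr.
Qed.

Lemma factor_ioM i x y : io i (x * y) = io i x * io i y.
Proof.
apply: factors_eq => j; rewrite rmorphM /=.
have [->|ji] := eqVneq j i; first by rewrite !ioK.
by rewrite !pi_io // mul0r.
Qed.

Lemma factor_io_pi i z : io i (pi i z) = z * io i 1.
Proof.
apply: factors_eq => j; rewrite rmorphM /=.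
have [->|ji] := eqVneq j i; first by rewrite !ioK mulr1.
by rewrite !pi_io // mulr0.
Qed.

(** Positivity prevents the involution from permuting the factors: if the idempotent [io i 1] were
    moved off the i-th factor, its product with its image would vanish. What remains is a nonzero
    idempotent of a field. *)
Lemma factor_pi_st1 i : pi i (st (io i 1)) = 1.
Proof.
have nz : pi i (st (io i 1)) != 0.
  apply/eqP=> h; have := factor_io_pi i (st (io i 1)).
  rewrite h linear0 => /esym h0.
  have : io i 1 = 0.
    by apply: (pos_trace_eq0 posT); rewrite (pos_traceC posT) h0 linear0.
  by move/(congr1 (pi i)); rewrite ioK linear0 => /eqP; rewrite oner_eq0.
apply: (mulfI nz); rewrite -rmorphM -(pos_trace_anti posT) -factor_ioM.
by rewrite !mulr1.
Qed.

Lemma factor_pi_st i z : pi i (st z) = pi i (st (io i (pi i z))).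
Proof.
by rewrite factor_io_pi (pos_trace_anti posT) rmorphM /= factor_pi_st1 mul1r.
Qed.

Lemma factor_involution i : exists s : {rmorphism L i -> L i},
  [/\ involutive s, forall z, pi i (st z) = s (pi i z) &
   exists TL : {scalar L i}, (forall y, TL (s y) = TL y) /\
     forall y, y != 0 -> 0 < TL (y * s y)].
Proof.
pose s y := pi i (st (io i y)).
have sa : {morph s : x y / x - y} by move=> x y; rewrite /s !linearB.
have sm : monoid_morphism s.
  split=> [|x y]; first exact: factor_pi_st1.
  by rewrite /s factor_ioM (pos_trace_anti posT) comZ rmorphM.
pose saM := GRing.isZmodMorphism.Build _ _ s sa.
pose smM := GRing.isMonoidMorphism.Build _ _ s sm.
pose sM : {rmorphism L i -> L i} := HB.pack s saM smM.
have sE z : pi i (st z) = sM (pi i z) by rewrite factor_pi_st.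
have sK : involutive sM by move=> y; rewrite -sE (pos_trace_stK posT) ioK.
have ioS y : io i (sM y) = st (io i y).
  apply: factors_eq => j; rewrite -{2}[y]mulr1 factor_ioM (pos_trace_anti posT).
  have [->|ji] := eqVneq j i.
    by rewrite ioK rmorphM /= factor_pi_st1 mul1r sE ioK.
  rewrite pi_io // rmorphM /=.
  suff -> : pi j (st (io i 1)) = 0 by rewrite mul0r.
  have := factor_pi_st j (io i 1); rewrite pi_io // !linear0 //.
exists sM; split=> //.
have tl : scalar (T \o io i) by move=> a x y; rewrite /= !linearP.
pose tlM := GRing.isLinear.Build _ _ _ _ (T \o io i) tl.
pose TL : {scalar L i} := HB.pack (T \o io i) tlM.
exists TL; split=> [y|y y0]; first by rewrite /= ioS (pos_trace_st posT).
rewrite /= factor_ioM ioS; apply: (pos_trace_gt0 posT).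
by apply: contraNneq y0 => /(congr1 (pi i)); rewrite ioK linear0 => ->.
Qed.

Lemma factors_of_product (P : fieldExtType rat -> Prop) :
  (forall i, P (L i)) -> product_of_fields P Z.
Proof.
move=> PL; exists n, L, (fun i => pi i : {rmorphism _ -> _}); split=> // y.
exists (\sum_i io i (y i)); split=> [i | z' zP]; last first.
  by rewrite -[RHS]sum_io; apply: eq_bigr => i _; rewrite zP.
rewrite rmorph_sum (bigD1 i) //= ioK big1 ?addr0 // => j ji.
by rewrite pi_io // eq_sym.
Qed.

End Factors.

(** * Number fields with a positive involution *)

Section GramSchmidt.
Variables (V : vectType rat) (B : V -> V -> rat).
Hypotheses (Bl : forall y, scalar (B^~ y)) (Bs : forall x y, B x y = B y x).
Hypothesis (Bp : forall x, x != 0 -> 0 < B x x).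

Definition orth_proj (e : seq V) y := \sum_(v <- e) (B y v / B v v) *: v.

Let B0 y : B 0 y = 0.
Proof. by have := Bl y (-1) 0 0; rewrite scaler0 addr0 mulN1r addNr. Qed.
Let BD x z y : B (x + z) y = B x y + B z y.
Proof. by have := Bl y 1 x z; rewrite scale1r mul1r. Qed.
Let BZ a x y : B (a *: x) y = a * B x y.
Proof. by have := Bl y a x 0; rewrite addr0 B0 addr0. Qed.
Let BB x z y : B (x - z) y = B x y - B z y.
Proof. by rewrite BD -scaleN1r BZ mulN1r. Qed.
Let Bsum (e : seq V) c y :
  B (\sum_(v <- e) c v *: v) y = \sum_(v <- e) c v * B v y.
Proof.
by elim: e => [|v e IH]; rewrite ?big_nil ?B0 // !big_cons BD BZ IH.
Qed.

(** The vectors are left unnormalised, since square roots of their lengths need not be rational;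
    [orth_proj] divides by [B v v] instead. *)
Lemma gram_schmidt (s : seq V) : exists e : seq V,
  [/\ {in e, forall v, v != 0}, {in e, forall v y, B (orth_proj e y) v = B y v}
    & {in s, forall y, orth_proj e y = y}].
Proof.
elim: s => [|x s [e [e0 eB es]]]; first by exists [::].
pose x' := x - orth_proj e x.
have x'e v : v \in e -> B x' v = 0 by move=> ve; rewrite BB eB // subrr.
have ex' y : B (orth_proj e y) x' = 0.
  rewrite Bsum big_seq big1 // => v ve.
  by rewrite [B v x']Bs x'e // mulr0.
have [x'0|x'0] := eqVneq x' 0.
  exists e; split=> // y; rewrite inE => /predU1P[->|/es//].
  by apply/eqP; rewrite eq_sym -subr_eq0 -/x' x'0.
have Bx'0 : B x' x' != 0 by rewrite gt_eqF // Bp.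
have pE y : orth_proj (x' :: e) y = (B y x' / B x' x') *: x' + orth_proj e y.
  by rewrite /orth_proj big_cons.
exists (x' :: e); split.
- by move=> v; rewrite inE => /predU1P[->|/e0].
- move=> v; rewrite inE => /predU1P[->|ve] y; rewrite pE BD BZ.
    by rewrite ex' addr0 mulfVK.
  by rewrite (x'e _ ve) mulr0 add0r eB.
move=> y; rewrite inE => /predU1P[->|/es ys]; rewrite pE; last first.
  by rewrite -[y in B y _]ys ex' mul0r scale0r add0r.
have -> : B x x' = B x' x' by rewrite {2}/x' BB ex' subr0.
by rewrite divff // scale1r subrK.
Qed.

Lemma orth_expansion : exists2 e : seq V, {in e, forall v, v != 0}
  & forall y, orth_proj e y = y.
Proof.
have [e [e0 _ es]] := gram_schmidt (vbasis fullv).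
exists e => // y; rewrite (coord_vbasis (memvf y)); set c := coord _.
have PD x z : orth_proj e (x + z) = orth_proj e x + orth_proj e z.
  by rewrite -big_split; apply: eq_bigr => v _; rewrite BD mulrDl scalerDl.
have PZ a x : orth_proj e (a *: x) = a *: orth_proj e x.
  by rewrite scaler_sumr; apply: eq_bigr => v _; rewrite BZ -mulrA scalerA.
have P0 : orth_proj e 0 = 0 by apply: big1 => v _; rewrite B0 mul0r scale0r.
rewrite (big_morph _ PD P0); apply: eq_bigr => i _.
by rewrite PZ es // memt_nth.
Qed.

End GramSchmidt.

Section CM.
Variables (L : fieldExtType rat) (st : {rmorphism L -> L}) (T : {scalar L}).
Hypotheses (stK : involutive st) (Tst : forall y, T (st y) = T y).
Hypothesis Tpos : forall y, y != 0 -> 0 < T (y * st y).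

(* Multiplication by [x] has adjoint multiplication by [st x] for the form
   T (x * st y); evaluating it at the vector of conjugates of an orthogonal
   basis gives the equality. *)
Lemma positive_conj (tau : {rmorphism L -> algC}) x : tau (st x) = (tau x)^*.
Proof.
pose B x y := T (x * st y).
have Bl y : scalar (B^~ y).
  by move=> a u v; rewrite /B mulrDl -scalerAl linearP.
have Bs u v : B u v = B v u by rewrite /B -Tst rmorphM stK mulrC.
have [e e0 eE] := orth_expansion Bl Bs Tpos.
(* Weighted squared length of the vector of conjugates [tau v]. It is nonzero because [e] contains a
   nonzero vector, as 1 expands in it. *)
pose N := \sum_(v <- e) (tau v * (tau v)^*) / ratr (B v v).
have Bp v : v \in e -> 0 < ratr (B v v) :> algC.
  by move=> ve; rewrite ltr0q Tpos // e0.
have N0 : N != 0.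
  rewrite gt_eqF // lt_neqAle; apply/andP; split; last first.
    by rewrite /N big_seq sumr_ge0 // => v /Bp vp;
      rewrite divr_ge0 ?mul_conjC_ge0 // ltW.
  rewrite eq_sym /N big_seq psumr_eq0; last first.
    by move=> v /Bp vp; rewrite divr_ge0 ?mul_conjC_ge0 // ltW.
  apply/negP=> /allP h.
  have: 1 != 0 :> L := oner_neq0 _; rewrite -(eE 1) /orth_proj big_seq.
  rewrite big1 ?eqxx // => v ve; have := h v ve;
    rewrite ve /= mulf_eq0 mul_conjC_eq0.
  by rewrite fmorph_eq0 (negPf (e0 v ve)) invr_eq0 gt_eqF // Bp.
pose S x := \sum_(v <- e) \sum_(w <- e)
  ratr (B (x * v) w) / (ratr (B v v) * ratr (B w w)) * (tau w * (tau v)^*).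
have tauS y : tau y * N = S y.
  rewrite /N mulr_sumr; apply: eq_bigr => v _.
  rewrite mulrA mulrA -rmorphM -{1}(eE (y * v)) /orth_proj rmorph_sum !mulr_suml.
  apply: eq_bigr => w _; rewrite rmorphZ_num.
  have -> : ratr (B (y * v) w / B w w) = ratr (B (y * v) w) / ratr (B w w) :> algC.
    exact: (fmorph_div ratr).
  move: (ratr (B (y * v) w)) (ratr (B w w)) (ratr (B v v)) (tau w) (tau v)^* => a b
    c p q.
  by rewrite invfM; move: b^-1 c^-1 => {}b {}c; ring.
have NR : N^* = N.
  rewrite rmorph_sum; apply: eq_bigr => v _;
    rewrite rmorphM fmorphV rmorphM /= conjCK.
  by rewrite fmorph_rat [tau v * _]mulrC.
apply: (mulIf N0); rewrite tauS -[in RHS]NR -rmorphM tauS rmorph_sum /S exchange_big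
  /=.
apply: eq_bigr => v _; rewrite rmorph_sum; apply: eq_bigr => w _.
(* The adjunction: replacing x by [st x] transposes the rational matrix of multiplication, which is
   what conjugating [S x] does. *)
have -> : B (st x * w) v = B (x * v) w.
  by rewrite /B -Tst !rmorphM !stK -mulrA [st w * v]mulrC mulrA.
have ratC q : (ratr q)^* = ratr q :> algC by exact: fmorph_rat.
move: (ratC (B (x * v) w)) (ratC (B v v)) (ratC (B w w)).
move: (ratr (B (x * v) w)) (ratr (B v v)) (ratr (B w w)) => a b c ha hb hc.
rewrite !rmorphM fmorphV rmorphM /= conjCK ha hb hc.
by rewrite [tau v * _]mulrC [c * _]mulrC.
Qed.

End CM.

Section CMField.
Variables (L : fieldExtType rat) (st : {rmorphism L -> L}) (T : {scalar L}).
Hypotheses (stK : involutive st) (Tst : forall y, T (st y) = T y).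
Hypothesis Tpos : forall y, y != 0 -> 0 < T (y * st y).

(** When [st] is nontrivial, the real subfield is its fixed field U. By [positive_conj], an x moved
    by [st] has no real conjugate. *)
Lemma totally_real_or_CM : (forall x, st x = x) \/ CM_field L.
Proof.
case: (classic (forall x, st x = x)) => [|nst]; [by left | right].
have [x0 x0P] : exists x, st x <> x by apply: not_all_ex_not.
have stZ a x : st (a *: x) = a *: st x by rewrite rmorphZ_num -alg_num_field
  mulr_algl.
split=> [tau|].
  exists x0; apply/negP=> /CrealP h; case: x0P.
  by apply: (fmorph_inj tau); rewrite (positive_conj stK Tst Tpos).
pose stL : {linear L -> L} := HB.pack (GRing.RMorphism.sort st)
  (GRing.isScalable.Build _ _ _ _ (GRing.RMorphism.sort st) stZ).
pose U := lker (linfun stL - \1)%VF.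
have UP x : (x \in U) = (st x == x).
  by rewrite memv_ker add_lfunE opp_lfunE !lfunE /= subr_eq0.
have Ua : is_aspace U.
  apply/andP; split; first by apply: has_algid1; rewrite UP rmorph1.
  apply/prodvP=> x y; rewrite !UP => /eqP xU /eqP yU.
  by rewrite rmorphM xU yU.
exists (ASpace Ua); split.
  move=> tau x; apply/CrealP/esym.
  have tl : scalar (T \o @vsval _ _ (ASpace Ua)) by move=> a y z;
    rewrite /= !linearP.
  pose TL : {scalar (subvs_of (ASpace Ua))} := HB.pack (T \o @vsval _ _ (ASpace Ua))
    (GRing.isLinear.Build _ _ _ _ (T \o @vsval _ _ (ASpace Ua)) tl).
  (* On U the identity is itself a positive involution, so every embedding of U is equal to its
     complex conjugate. *)
  have := @positive_conj (subvs_of (ASpace Ua)) idfun TL; apply=> //=.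
  move=> y y0; have : vsval y \in U := subvsP y.
  rewrite UP => /eqP yU; rewrite -{2}yU.
  by apply: Tpos; apply: contraNneq y0 => h; apply/eqP/val_inj.
(* A nonzero element negated by [st]: halving x + st x and x - st x gives L as the direct sum of U
   and U th. *)
pose th := x0 - st x0.
have stth : st th = - th by rewrite rmorphB stK opprB.
have th0 : th != 0 by rewrite subr_eq0 eq_sym; apply/eqP.
have sumU : (U + U * <[th]> = fullv)%VS.
  apply/eqP; rewrite eqEsubv subvf; apply/subvP=> x _.
  apply/memv_addP; exists (2%:R^-1 *: (x + st x)).
    by rewrite UP stZ rmorphD stK addrC.
  exists (2%:R^-1 *: (x - st x)).
    apply/memv_cosetP; exists (2%:R^-1 *: ((x - st x) / th)).
      by rewrite UP stZ fmorph_div stth rmorphB stK invrN mulrN -mulNr opprB.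
    by rewrite -scalerAl mulfVK.
  rewrite -scalerDr addrACA subrr addr0 -mulr2n -scaler_nat scalerA mulVf ?scale1r
    //.
have capU : (U :&: U * <[th]> = 0)%VS.
  apply/eqP; rewrite -subv0; apply/subvP=> x /[!memv_cap] /andP[].
  rewrite UP => /eqP xU /memv_cosetP[y]; rewrite UP => /eqP yU xE.
  move: xU; rewrite xE rmorphM yU stth mulrN => /eqP.
  by rewrite eq_sym -addr_eq0 -mulr2n -scaler_nat scaler_eq0 /= memv0.
by rewrite -sumU dimv_disjoint_sum // dim_cosetv // addnn -muln2 mulKn ?adim_gt0 //
  (adim_gt0 (ASpace Ua)).
Qed.

End CMField.

(** A primitive element t is sent to a complex root z of its minimal polynomial. The map is defined
    through a chosen polynomial representing x at t; [H0] shows that the choice does not matter. *)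
Lemma numfield_embeds (L : fieldExtType rat) : exists _ : {rmorphism L -> algC},
  True.
Proof.
have ch0 : has_pchar0 L by move=> i; rewrite pchar_lalg pchar_num.
have sepL : separable 1 {:L} by apply/separableP=> x _; apply: pcharf0_separable.
have genL := eq_adjoin_separable_generator sepL (sub1v _).
set t := separable_generator _ _ in genL.
have [p pE] : exists p, minPoly 1 t = map_poly (in_alg L) p.
  by apply/polyOver1P/minPolyOver.
pose H (q : {poly rat}) := (map_poly (in_alg L) q).[t].
have HP x : exists q, H q == x.
  have xt : x \in <<1; t>>%VS by rewrite -genL memvf.
  have /polyOver1P[q qE] := Fadjoin_polyOver 1 t x.
  by exists q; rewrite /H -qE Fadjoin_poly_eq.
have /closed_rootP[z /rootP zP] : size (map_poly (ratr : rat -> algC) p) != 1%N.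
  by rewrite size_map_poly -(size_map_poly (in_alg L)) -pE size_minPoly.
have H0 q : H q = 0 -> (map_poly (ratr : rat -> algC) q).[z] = 0.
  move=> /eqP qt; have : (p %| q)%R.
    rewrite -(dvdp_map (in_alg L)) -pE minPoly_dvdp //.
    by apply/polyOver1P; exists q.
  by case/dvdpP=> r ->; rewrite rmorphM hornerM zP mulr0.
have HB q r : H (q - r) = H q - H r by rewrite /H rmorphB hornerD hornerN.
pose tau x := (map_poly (ratr : rat -> algC) (xchoose (HP x))).[z].
have tauE q : tau (H q) = (map_poly ratr q).[z].
  apply/eqP; rewrite -subr_eq0 -hornerN -hornerD -rmorphB; apply/eqP/H0.
  by rewrite HB (eqP (xchooseP (HP (H q)))) subrr.
have HE x : exists q, x = H q by have [q /eqP <-] := HP x; exists q.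
have ta : {morph tau : x y / x - y}.
  move=> x y; have [q ->] := HE x; have [r ->] := HE y.
  by rewrite -HB !tauE rmorphB hornerD hornerN.
have tm : monoid_morphism tau.
  split=> [|x y].
    have -> : 1 = H 1 by rewrite /H rmorph1 hornerC.
    by rewrite tauE rmorph1 hornerC.
  have [q ->] := HE x; have [r ->] := HE y.
  have -> : H q * H r = H (q * r) by rewrite /H rmorphM hornerM.
  by rewrite !tauE rmorphM hornerM.
by exists (HB.pack_for {rmorphism L -> algC} tau
  (GRing.isZmodMorphism.Build _ _ tau ta) (GRing.isMonoidMorphism.Build _ _ tau tm)).
Qed.

(** * The positive trace form of E^k[m, f] *)

Lemma alg_trace_is_scalar (A : falgType rat) : scalar (@alg_trace rat A).
Proof.
move=> a x y; rewrite /alg_trace mulr_sumr -big_split; apply: eq_bigr => i _ /=.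
by rewrite mulrDl -scalerAl linearP.
Qed.
HB.instance Definition _ (A : falgType rat) :=
  GRing.isLinear.Build rat A rat _ (@alg_trace rat A) (@alg_trace_is_scalar A).

Lemma alg_traceC (A : falgType rat) (x y : A) : alg_trace (x * y) = alg_trace (y *
  x).
Proof.
have E (u v : A) : alg_trace (u * v) = \sum_(i < \dim {:A}) \sum_(l < \dim {:A})
    coord (vbasis {:A}) l (v * (vbasis {:A})`_i) *
    coord (vbasis {:A}) i (u * (vbasis {:A})`_l).
  apply: eq_bigr => i _; rewrite -mulrA.
  rewrite {1}(coord_vbasis (memvf (v * (vbasis {:A})`_i))).
  by rewrite mulr_sumr linear_sum; apply: eq_bigr => l _; rewrite -scalerAr linearZ.
rewrite !E exchange_big; apply: eq_bigr => i _; apply: eq_bigr => l _.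
exact: mulrC.
Qed.

Section SkewTrace.
Variables (E : falgType rat) (star : {linear E -> E}).
Hypothesis star_pos : positive_involution star.
Variables (m k : nat) (f : {lrmorphism power E k.+1 -> power E k.+1}).
Hypothesis f_star : forall x, f (powmap star x) = powmap star (f x).
Hypothesis f_m : iter m.+1 f =1 id.
Notation R := (power E k.+1).
Notation A := (skew_alg f_m).
Notation ps := (@powmap E k.+1 star).

Lemma starM x y : star (x * y) = star y * star x.
Proof. by case: star_pos. Qed.
Lemma starK : involutive star.
Proof. by case: star_pos. Qed.

Lemma psM (x y : R) : ps (x * y) = ps y * ps x.
Proof. by apply/ffunP=> i; rewrite !ffunE starM. Qed.
Lemma psK : involutive ps.
Proof. by move=> x; apply/ffunP=> i; rewrite !ffunE starK. Qed.
Fact ps_is_linear : linear ps.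
Proof. by move=> a x y; apply/ffunP=> i; rewrite !ffunE linearP. Qed.
HB.instance Definition _ := GRing.isLinear.Build rat R R _ ps ps_is_linear.

Lemma iter_ps n x : iter n f (ps x) = ps (iter n f x).
Proof. by elim: n => //= n ->. Qed.
Lemma iter_linear n : linear (iter n f).
Proof. by move=> a x y; elim: n => //= n ->; rewrite linearP. Qed.
Lemma iterf_add n : {morph iter n f : x y / x + y}.
Proof. by move=> x y; elim: n => //= n ->; rewrite rmorphD. Qed.
Lemma iterf_mul n : {morph iter n f : x y / x * y}.
Proof. by move=> x y; elim: n => //= n ->; rewrite rmorphM. Qed.
Lemma iterf0 n : iter n f 0 = 0.
Proof. by elim: n => //= n ->; rewrite rmorph0. Qed.
Lemma iterf1 n : iter n f 1 = 1.
Proof. by elim: n => //= n ->; rewrite rmorph1. Qed.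
Lemma iter_sum n I (r : seq I) (P : pred I) (g : I -> R) :
  iter n f (\sum_(i <- r | P i) g i) = \sum_(i <- r | P i) iter n f (g i).
Proof. exact: (big_morph _ (iterf_add n) (iterf0 n)). Qed.
Lemma iter_mod n (r : R) : iter (n %% m.+1) f r = iter n f r.
Proof.
rewrite [in RHS](divn_eq n m.+1) addnC iterD; congr iter.
by elim: (n %/ m.+1)%N => // q IH; rewrite mulSn iterD -IH f_m.
Qed.
Lemma iter_ord_add (i j : 'I_m.+1) (r : R) : iter i f (iter j f r) = iter (i + j)%R
  f r.
Proof. by rewrite -iterD -iter_mod. Qed.

(* Averaging over the powers of f makes the trace f-invariant. *)
Definition pow_trace (x : R) : rat :=
  \sum_(n < m.+1) \sum_j alg_trace (iter n f x j).

Lemma pow_traceD x y : pow_trace (x + y) = pow_trace x + pow_trace y.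
Proof.
rewrite /pow_trace -big_split; apply: eq_bigr => n _.
by rewrite -big_split; apply: eq_bigr => j _; rewrite iterf_add ffunE linearD.
Qed.
Lemma pow_traceZ a x : pow_trace (a *: x) = a * pow_trace x.
Proof.
rewrite /pow_trace mulr_sumr; apply: eq_bigr => n _.
rewrite mulr_sumr; apply: eq_bigr => j _.
have := iter_linear n a x 0; rewrite iterf0 !addr0 => ->.
by rewrite ffunE linearZ.
Qed.
Lemma pow_trace0 : pow_trace 0 = 0.
Proof. by have := pow_traceZ 0 0; rewrite scale0r mul0r. Qed.
Lemma pow_trace_sum I (r : seq I) (P : pred I) (g : I -> R) :
  pow_trace (\sum_(i <- r | P i) g i) = \sum_(i <- r | P i) pow_trace (g i).
Proof. exact: (big_morph _ pow_traceD pow_trace0). Qed.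
Lemma pow_traceC x y : pow_trace (x * y) = pow_trace (y * x).
Proof.
apply: eq_bigr => n _; apply: eq_bigr => j _.
by rewrite !iterf_mul !ffunE alg_traceC.
Qed.
Lemma pow_trace_f x : pow_trace (f x) = pow_trace x.
Proof.
rewrite /pow_trace big_ord_recr [RHS]big_ord_recl /= addrC; congr (_ + _).
  by rewrite -iterSr f_m.
by apply: eq_bigr => n _; rewrite -iterSr.
Qed.
Lemma pow_trace_iter n x : pow_trace (iter n f x) = pow_trace x.
Proof. by elim: n => //= n IH; rewrite pow_trace_f. Qed.
Lemma pow_trace_ge0 x : 0 <= pow_trace (x * ps x).
Proof.
apply: sumr_ge0 => n _; apply: sumr_ge0 => j _; rewrite iterf_mul iter_ps !ffunE.
have [->|nz] := eqVneq (iter n f x j) 0; first by rewrite mul0r linear0.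
by case: star_pos => _ _ h; rewrite ltW // h.
Qed.
Lemma pow_trace_eq0 x : pow_trace (x * ps x) = 0 -> x = 0.
Proof.
move/eqP; rewrite psumr_eq0 => [/allP/(_ ord0 (mem_index_enum _))|n _]; last first.
  apply: sumr_ge0 => j _; rewrite iterf_mul iter_ps !ffunE.
  have [->|nz] := eqVneq (iter n f x j) 0; first by rewrite mul0r linear0.
  by case: star_pos => _ _ h; rewrite ltW // h.
rewrite /= psumr_eq0 => [/allP h|j _]; last first.
  rewrite !ffunE; have [->|nz] := eqVneq (x j) 0; first by rewrite mul0r linear0.
  by case: star_pos => _ _ h; rewrite ltW // h.
apply/ffunP=> j; rewrite [RHS]ffunE; apply/eqP/contraT=> nz.
case: star_pos => _ _ /(_ _ nz); have := h j (mem_index_enum _).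
by rewrite /= !ffunE => /eqP ->; rewrite ltxx.
Qed.

Definition skew_star (x : A) : A := [ffun l : 'I_m.+1 => iter l f (ps (x (- l)))].
Fact skew_star_is_linear : linear skew_star.
Proof.
move=> a x y; apply/ffunP=> l; rewrite !ffunE linearP.
exact: iter_linear.
Qed.
HB.instance Definition _ :=
  GRing.isLinear.Build rat A A _ skew_star skew_star_is_linear.

Lemma skew_starM x y : skew_star (x * y) = skew_star y * skew_star x.
Proof.
apply/ffunP=> l; rewrite !ffunE linear_sum iter_sum [RHS](reindex_inj (addIr l)).
apply: eq_bigr => i _; rewrite -[_ (x i * _)]/(ps (x i * _)) psM iterf_mul !ffunE
  -iter_ps !iter_ord_add.
have -> : i + l + (l - (i + l)) = l by rewrite addrC subrK.
have -> : - (l - (i + l)) = i by rewrite opprB addrK.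
by rewrite [l + i]addrC opprD [- i - l]addrC.
Qed.

Lemma skew_starK : involutive skew_star.
Proof.
move=> x; apply/ffunP=> l; rewrite !ffunE -iter_ps psK iter_ord_add.
by rewrite subrr opprK.
Qed.

(* The second term makes the form invariant under the involution. *)
Definition skew_trace (x : A) : rat := pow_trace (x 0) + pow_trace (ps (x 0)).
Fact skew_trace_is_scalar : scalar skew_trace.
Proof.
move=> a x y; rewrite /skew_trace !ffunE linearP !pow_traceD !pow_traceZ.
by rewrite mulrDr addrACA.
Qed.
HB.instance Definition _ :=
  GRing.isLinear.Build rat A rat _ skew_trace skew_trace_is_scalar.

(** Exchanging the terms i and -i requires a trace that is both symmetric and invariant under f,
    hence the averaging in [pow_trace]. *)
Lemma pow_trace_coord0C (x y : A) : pow_trace ((x * y) 0) = pow_trace ((y * x) 0).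
Proof.
rewrite !ffunE !pow_trace_sum [RHS](reindex_inj oppr_inj).
apply: eq_bigr => i _; rewrite !sub0r opprK -[RHS](pow_trace_iter i) iterf_mul.
by rewrite iter_ord_add subrr pow_traceC.
Qed.

Lemma skew_star0 (x : A) : skew_star x 0 = ps (x 0).
Proof. by rewrite ffunE oppr0. Qed.

Lemma skew_pos_trace : pos_trace skew_star skew_trace.
Proof.
split; [exact: skew_starM | exact: skew_starK | | |].
- move=> x y; rewrite /= /skew_trace pow_trace_coord0C -!skew_star0 !skew_starM.
  by congr (_ + _); apply: pow_trace_coord0C.
- by move=> x; rewrite /= /skew_trace !skew_star0 psK addrC.
move=> x x0.
rewrite /=.
have -> : skew_trace (x * skew_star x) = 2%:R * pow_trace ((x * skew_star x) 0).
  rewrite /skew_trace -skew_star0 skew_starM skew_starK.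
  by rewrite mulr_natl mulr2n.
rewrite pmulr_rgt0 // ffunE pow_trace_sum.
(* The degree 0 coefficient of x times its star is the sum of the x_i [ps] x_i, as the powers of f
   cancel. *)
have xE i : pow_trace (x i * iter i f (skew_star x (0 - i))) = pow_trace (x i * ps
  (x i)).
  by rewrite ffunE iter_ord_add sub0r subrr opprK.
under eq_bigr => i _ do rewrite xE.
rewrite lt_neqAle sumr_ge0 ?andbT => [|i _]; last exact: pow_trace_ge0.
rewrite eq_sym psumr_eq0 => [|i _]; last exact: pow_trace_ge0.
apply: contra x0 => /allP h; apply/eqP/ffunP=> i; rewrite [RHS]ffunE.
by apply: pow_trace_eq0; apply/eqP/h; rewrite mem_index_enum.
Qed.

End SkewTrace.

Section SubTrace.
Variables (A : falgType rat) (st : {linear A -> A}) (T : {scalar A}).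
Hypothesis posT : pos_trace st T.
Variable B : {aspace A}.
Hypothesis (stB : forall x, x \in B -> st x \in B).

Definition sub_st (x : subvs_of B) : subvs_of B := vsproj B (st (vsval x)).
Lemma sub_stE x : vsval (sub_st x) = st (vsval x).
Proof. by rewrite vsprojK // stB // subvsP. Qed.
Fact sub_st_is_linear : linear sub_st.
Proof. by move=> a x y; rewrite /sub_st !linearP. Qed.
HB.instance Definition _ :=
  GRing.isLinear.Build rat (subvs_of B) (subvs_of B) _ sub_st sub_st_is_linear.
Definition sub_trace (x : subvs_of B) : rat := T (vsval x).
Fact sub_trace_is_scalar : scalar sub_trace.
Proof. by move=> a x y; rewrite /sub_trace !linearP. Qed.
HB.instance Definition _ :=
  GRing.isLinear.Build rat (subvs_of B) rat _ sub_trace sub_trace_is_scalar.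

Lemma sub_pos_trace : pos_trace sub_st sub_trace.
Proof.
split=> [x y|x|x y|x|x x0]; rewrite /= /sub_trace.
- by apply: val_inj; rewrite /= sub_stE /= !sub_stE (pos_trace_anti posT).
- by apply: val_inj; rewrite /= !sub_stE (pos_trace_stK posT).
- exact: (pos_traceC posT).
- by rewrite /= sub_stE (pos_trace_st posT).
by rewrite /= sub_stE (pos_trace_gt0 posT).
Qed.
End SubTrace.

(** * Automorphisms of matrix algebras, and a splitting criterion *)

(** Only the coefficient of [chi] is claimed to vanish, so the [s i] may coincide with one another
    or be zero, as happens in the application. The usual elimination of the last character proves
    it. *)
Lemma dedekind_independence (X : pzRingType) (M : fieldType) (chi : X -> M) (s : nat
  -> X -> M)
    (N : nat) (a : nat -> M) (b : M) :
  chi 1 = 1 -> {morph chi : c d / c * d} -> (forall i, {morph s i : c d / c * d}) ->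
  (forall i, (i < N)%N -> exists d, chi d <> s i d) ->
  (forall c, b * chi c = \sum_(i < N) a i * s i c) -> b = 0.
Proof.
move=> chi1 chiM sM; elim: N a b => [|N IH] a b ne rel.
  by have := rel 1; rewrite chi1 mulr1 big_ord0.
have [d dP] := ne N (ltnSn N).
have : b * (chi d - s N d) = 0.
  apply: (IH (fun i => a i * (s i d - s N d))) => [i iN | c].
    by apply: ne; apply: leq_trans iN _.
  rewrite mulrBr mulrBl -[b * chi d * chi c]mulrA -chiM rel -mulrA [s N d * _]mulrC
    mulrA rel.
  rewrite mulr_suml -sumrB big_ord_recr /= sM mulrA.
  rewrite [a N * s N d * _]mulrAC subrr addr0.
  apply: eq_bigr => i _; rewrite sM mulrBr mulrBl mulrA; congr (_ - _).
  by rewrite mulrAC.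
by move/eqP; rewrite mulf_eq0 subr_eq0 => /orP[/eqP //|/eqP].
Qed.

Section MatrixAut.
Variables (K : fieldType) (d : nat).
Notation Mat := 'M[K]_d.+1.

Lemma cent_scalar_mx (X : Mat) : central X -> exists c, X = c%:M.
Proof.
move=> XC; exists (X 0 0); apply/matrixP=> i j; rewrite mxE.
have E a b i' j' : X i' a *+ (j' == b) = X b j' *+ (i' == a).
  have /matrixP/(_ i' j') := XC (delta_mx a b); rewrite !mxE.
  rewrite (bigD1 a) //= big1 ?addr0 => [|k /negPf ka]; last by rewrite mxE ka mulr0.
  rewrite (bigD1 b) //= big1 ?addr0 => [|k /negPf kb];
    last by rewrite mxE kb andbF mul0r.
  by rewrite !mxE !eqxx /= mulr_natr andbT mulr_natl => ->.
have [-> | ij] := eqVneq i j; last first.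
  by have := E j j i j; rewrite eqxx (negPf ij).
by have := E j 0 j 0; rewrite !eqxx !mulr1n.
Qed.

Lemma skolem_noether (phi : {rmorphism Mat -> Mat}) :
  (forall c, phi c%:M = c%:M) ->
  exists2 P : Mat, P \is a GRing.unit & forall X, phi X * P = P * X.
Proof.
move=> phiC.
have phiZ c X : phi (c *: X) = c *: phi X.
  by rewrite -!mul_scalar_mx !mulmxE rmorphM phiC.
have dd i j k l : delta_mx i j * delta_mx k l = delta_mx i l *+ (j == k) :> Mat.
  by rewrite -mulmxE mul_delta_mx_cond.
have nz : phi (delta_mx 0 0) != 0.
  apply/eqP=> h; have : (1 : Mat) != 0 := oner_neq0 _.
  rewrite -(rmorph1 phi) [1]matrix_sum_delta rmorph_sum big1 ?eqxx // => i _.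
  rewrite rmorph_sum big1 // => j _; rewrite phiZ.
  have -> : delta_mx i j = delta_mx i 0 * delta_mx 0 0 * delta_mx 0 j :> Mat.
    by rewrite dd eqxx mulr1n dd eqxx mulr1n.
  by rewrite !rmorphM h mulr0 mul0r scaler0.
have [a [b abP]] : exists a b, phi (delta_mx 0 0) a b != 0.
  apply: NNPP => h; case/negP: nz; apply/eqP/matrixP=> a b; rewrite mxE.
  by apply/eqP/contraT=> ab; case: h; exists a, b.
(* Column i of P is column b of [phi (delta_mx i 0)]; b is a nonzero column of [phi (delta_mx 0 0)],
   so P is nonzero. *)
pose P : Mat := \sum_i phi (delta_mx i 0) * delta_mx b 0 * delta_mx 0 i.
have Pd k l : P * delta_mx k l = phi (delta_mx k 0) * delta_mx b 0 * delta_mx 0 l.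
  rewrite mulr_suml (bigD1 k) //= big1 ?addr0.
    by rewrite -[LHS]mulrA dd eqxx mulr1n.
  by move=> i /negPf ik; rewrite -[LHS]mulrA dd ik mulr0n mulr0.
have phiP X : phi X * P = P * X.
  rewrite [X]matrix_sum_delta rmorph_sum mulr_suml mulr_sumr; apply: eq_bigr => k _.
  rewrite rmorph_sum mulr_suml mulr_sumr; apply: eq_bigr => l _.
  rewrite phiZ -scalerAl -scalerAr Pd; congr (_ *: _).
  rewrite mulr_sumr (bigD1 l) //= big1 ?addr0.
    by rewrite !mulrA -rmorphM dd eqxx mulr1n.
  by move=> i /negPf il; rewrite !mulrA -rmorphM dd eq_sym il mulr0n raddf0 !mul0r.
exists P => //.
have P0 : P != 0.
  apply: contraNneq abP => P0; have /matrixP/(_ a 0) := Pd 0 0.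
  rewrite P0 mul0r -mulrA dd eqxx mulr1n !mxE => /esym /eqP.
  rewrite (bigD1 b) //= big1 ?addr0; first by rewrite mxE !eqxx mulr1.
  by move=> i /negPf ib; rewrite mxE ib mulr0.
apply: contraNT P0 => nP.
(* The kernel of P is stable under every matrix, since P X = phi X P; if it contains a nonzero u,
   moving u to every basis vector gives P = 0. *)
have nfr : ~~ row_free P^T by rewrite row_free_unit unitmx_tr.
have : kermx P^T != 0 by rewrite kermx_eq0.
case/rowV0Pn=> u /sub_kermxP uP u0.
have Pu : P *m u^T = 0 by rewrite -[P]trmxK -trmx_mul uP trmx0.
have [j uj] : exists j, u 0 j != 0.
  apply: NNPP => h; case/negP: u0; apply/eqP/matrixP=> i j; rewrite mxE ord1.
  by apply/eqP/contraT=> ij; case: h; exists j.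
apply/eqP/matrixP=> i k; rewrite [RHS]mxE.
have : P *m delta_mx k j *m u^T = 0.
  by rewrite -[P *m _]phiP -mulmxE -mulmxA Pu mulmx0.
move/matrixP/(_ i 0); rewrite -mulmxA mxE [RHS]mxE (bigD1 k) //= big1 ?addr0.
  rewrite mxE (bigD1 j) //= big1 ?addr0.
    by rewrite !mxE !eqxx mul1r => /eqP; rewrite mulf_eq0 (negPf uj) orbF => /eqP.
  by move=> l /negPf lj; rewrite !mxE lj andbF mul0r.
move=> l /negPf lk; rewrite mxE big1 ?mulr0 // => t _.
by rewrite !mxE lk mul0r.
Qed.

Lemma mulr_scalar_mxC c (X : Mat) : c%:M * X = X * c%:M.
Proof. by rewrite -mulmxE scalar_mxC. Qed.

Section Norms.
Variables (st : {additive Mat -> Mat}) (x : Mat).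
Hypotheses (stM : forall X Y, st (X * Y) = st Y * st X) (stK : involutive st).

Lemma mx_anti1 : st 1 = 1.
Proof. by rewrite -[LHS]mulr1 -{2}[1]stK -stM mulr1 stK. Qed.

(* [h \o st] is a K-linear anti-automorphism, hence X |-> P X^T P^-1, whose
   square is conjugation by P P^-T; so x = c (P P^-T)^-1, and [st x] is the
   image c P P^-T of x. *)
Lemma norm_square_semilinear (h : {rmorphism Mat -> Mat}) :
  (forall X, h (st X) = st (h X)) -> (forall c, h (st c%:M) = c%:M) ->
  (forall X, x * h (h X) = X * x) -> h x = x ->
  exists c, x * st x = (c ^+ 2)%:M.
Proof.
move=> hst hC xh hx.
pose ta X := h (st X).
have taM X Y : ta (X * Y) = ta Y * ta X by rewrite /ta stM rmorphM.
pose ph (X : Mat) := ta X^T.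
have pa : {morph ph : X Y / X - Y}.
  by move=> X Y; rewrite /ph /ta raddfB raddfB rmorphB.
have pm : monoid_morphism ph.
  split=> [|X Y]; first by rewrite /ph /ta trmx1 mx_anti1 rmorph1.
  by rewrite /ph -mulmxE trmx_mul !mulmxE taM.
pose phM : {rmorphism Mat -> Mat} := HB.pack ph
  (GRing.isZmodMorphism.Build _ _ ph pa) (GRing.isMonoidMorphism.Build _ _ ph pm).
have phC c : phM c%:M = c%:M by rewrite /= /ph tr_scalar_mx; apply: hC.
have [P Pu PE] := skolem_noether phC.
have taE X : ta X = P * X^T * P^-1.
  by apply: (mulIr Pu); rewrite mulrVK // -PE /= /ph trmxK.
have PTu : P^T \is a GRing.unit by rewrite unitmxE det_tr -unitmxE.
have trV : (P^-1)^T = (P^T)^-1 by apply: trmx_inv.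
have hh X : h (h X) = P / P^T * X * (P^T / P).
  have -> : h (h X) = ta (ta X) by rewrite /ta -hst stK.
  by rewrite !taE -!mulmxE !trmx_mul trmxK trV !mulmxE !mulrA.
have [c cE] : exists c, x * (P / P^T) = c%:M.
  apply: cent_scalar_mx => Y; rewrite [RHS]mulrA -xh hh !mulrA.
  by rewrite mulrVK // mulrK.
exists c.
have xE : x = c%:M * (P^T / P) by rewrite -cE !mulrA mulrVK // mulrK.
have -> : st x = ta x by rewrite /ta hst hx.
have -> : ta x = c%:M * (P / P^T).
  rewrite xE taM [ta c%:M]hC -mulr_scalar_mxC; congr (_ * _).
  by rewrite taE -mulmxE !trmx_mul trmxK trV mulmxE !mulrA mulrK.
by rewrite mulr_scalar_mxC mulrA cE expr2 scalar_mxM mulmxE.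
Qed.

(** Here g is conjugation by some y, and the hypotheses make three elements scalar: x y^2 = k, st y
    * y = n and y^-1 h(y) = t. Applying h to k gives st k = k t^2, while k st k = n^2 x st x; so x
    st x is the square of k t / n. *)
Lemma norm_square_linear (h g : {rmorphism Mat -> Mat}) :
  (forall X, exists Y, h Y = X) ->
  (forall X, g (st X) = st (g X)) -> (forall X, g (h X) = h (g X)) ->
  (forall c, g c%:M = c%:M) -> (forall c, h c%:M = st c%:M) ->
  (forall X, x * g (g X) = X * x) -> h x = x ->
  exists c, x * st x = (c ^+ 2)%:M.
Proof.
move=> hs gst gh gC hC xg hx.
have [y yu yE] := skolem_noether gC.
have gE X : g X = y * X / y by rewrite -yE mulrK.
have [k kE] : exists c, x * (y * y) = c%:M.
  apply: cent_scalar_mx => X; rewrite !mulrA -xg !gE.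
  by rewrite !mulrA !mulrVK.
have syu : st y \is a GRing.unit.
  apply/unitrP; exists (st y^-1); rewrite -!stM mulrV // mulVr // mx_anti1 //.
have [n nE] : exists c, st y * y = c%:M.
  apply: cent_scalar_mx => X; have := gst (st X); rewrite stK => gX.
  have sX : st (g (st X)) = g X by rewrite gst stK.
  have : st y * g X = X * st y by rewrite -sX gE -stM mulrVK // stM stK.
  by rewrite gE => /(congr1 (fun z => z * y)); rewrite !mulrA mulrVK.
have hyu : h y \is a GRing.unit by apply: rmorph_unit.
have [t tE] : exists c, y^-1 * h y = c%:M.
  apply: cent_scalar_mx => X; have [Y <-] := hs X.
  have : h (g Y) * h y = h y * h Y by rewrite -rmorphM yE rmorphM.
  by rewrite -gh gE => E; rewrite -mulrA -E -!mulrA mulKr.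
have hyE : h y = y * t%:M by rewrite -tE mulVKr.
have skE : st k%:M = (k * t ^+ 2)%:M.
  have ytyt : y * t%:M * (y * t%:M) = y * y * (t ^+ 2)%:M.
    rewrite expr2 scalar_mxM mulmxE -!mulrA; congr (y * _).
    by rewrite !mulrA mulr_scalar_mxC.
  rewrite -hC -{1}kE 2!(rmorphM h) hx hyE ytyt [x * _]mulrA kE.
  by rewrite -mulmxE -scalar_mxM.
have n0 : n != 0.
  have : n%:M \is a @GRing.unit Mat by rewrite -nE unitrMl.
  by apply: contraTneq => ->; rewrite raddf0 unitr0.
have ysy : y * st y = n%:M.
  by apply: (mulIr yu); rewrite -mulrA nE mulr_scalar_mxC.
exists (k * t / n).
have nu : (n ^+ 2)%:M \is a @GRing.unit Mat.
  by rewrite unitmxE det_scalar unitfE expf_neq0 // expf_neq0.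
apply: (mulrI nu); rewrite -mulmxE -[RHS]scalar_mxM mulmxE.
have -> : n ^+ 2 * (k * t / n) ^+ 2 = k * (k * t ^+ 2).
  by rewrite expr_div_n mulrC divfK ?expf_neq0 // exprMn expr2 mulrA.
rewrite [RHS]scalar_mxM mulmxE -skE -{2}kE !stM -kE.
rewrite expr2 scalar_mxM mulmxE mulrA -[_ * _ * x]mulrA 2!mulr_scalar_mxC.
rewrite -!mulrA; congr (_ * _).
rewrite [y * (st y * _)]mulrA ysy [n%:M * (st y * _)]mulrA [n%:M * st
  y]mulr_scalar_mxC.
by rewrite !mulrA ysy.
Qed.

End Norms.
End MatrixAut.

Lemma central_inverse (R : nzRingType) (z z' : R) :
  central z -> z * z' = 1 -> central z'.
Proof.
move=> zC zz' a; rewrite -[LHS]mulr1 -zz' mulrA -[z' * a * z]mulrA -(zC a).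
by rewrite [z' * (z * a)]mulrA -(zC z') zz' mul1r.
Qed.

(** * Splitting a simple algebra by an idempotent whose corner is central *)

Section Criterion.
Variables (F : fieldType) (B : falgType F) (p : B).
Hypotheses (simB : simple_alg B) (p0 : p != 0) (pp : p * p = p).
Hypothesis pBp : forall b, exists2 z, central z & p * b * p = z * p.

Lemma center_valP (z : center_alg B) : central (vsval z).
Proof. exact/mem_center/subvsP. Qed.

Lemma central_p0 z : central z -> z * p = 0 -> z = 0.
Proof.
move=> zC zp; apply/eqP/contraT=> z0.
have [z' zz'] := simple_central_inv simB zC z0.
by case/negP: p0; rewrite -[p]mul1r -zz' zC -mulrA zp mulr0.
Qed.

(** Dual families in B p and p B: the products [v i * w j] are matrix units, forming a full system
    exactly when the [v i * w i] add up to 1. *)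
Definition biorth n (v w : 'I_n -> B) : Prop :=
  [/\ forall i, v i * p = v i, forall i, p * w i = w i
    & forall i j, w i * v j = p *+ (i == j)].

Lemma biorth_size n (v w : 'I_n -> B) : biorth v w -> (n <= \dim {:B})%N.
Proof.
case=> vp pw wv.
have : free [tuple v i | i < n].
  apply/freeP=> c c0 i.
  have : w i * \sum_(j < n) c j *: [tuple v i | i < n]`_j = 0 by rewrite c0 mulr0.
  rewrite mulr_sumr (bigD1 i) //= big1 ?addr0 => [|j /negPf ji]; last first.
    by rewrite (nth_map i) ?size_enum_ord // nth_ord_enum -scalerAr wv eq_sym ji
      scaler0.
  rewrite (nth_map i) ?size_enum_ord // nth_ord_enum -scalerAr wv eqxx => /eqP.
  by rewrite scaler_eq0 (negPf p0) orbF => /eqP.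
rewrite /free => /eqP; rewrite size_tuple => <-.
exact: dimvS (subvf _).
Qed.

(* A remainder g = 1 - \sum_i v i * w i is an idempotent annihilating the system;
   if it is nonzero, then p B g B p is nonzero by simplicity and yields one more
   pair. *)
Lemma biorth_extend n (v w : 'I_n -> B) : biorth v w ->
  \sum_i v i * w i = 1 \/ exists v' w' : 'I_n.+1 -> B, biorth v' w'.
Proof.
case=> vp pw wv; pose g := 1 - \sum_i v i * w i.
have [g0|g0] := eqVneq g 0.
  by left; apply/esym/eqP; rewrite -subr_eq0 -/g g0.
right.
have wg i : w i * g = 0.
  rewrite mulrBr mulr1 mulr_sumr (bigD1 i) //= big1 => [|j /negPf ji]; last first.
    by rewrite mulrA wv eq_sym ji mul0r.
  by rewrite addr0 mulrA wv eqxx pw subrr.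
have gv i : g * v i = 0.
  rewrite mulrBl mul1r mulr_suml (bigD1 i) //= big1 => [|j /negPf ji]; last first.
    by rewrite -mulrA wv ji mulr0.
  by rewrite addr0 -mulrA wv eqxx vp subrr.
have gg : g * g = g.
  rewrite {1}/g mulrBl mul1r mulr_suml big1 ?subr0 // => i _.
  by rewrite -mulrA wg mulr0.
have [a [b abP]] : exists a b, p * a * g * b * p != 0.
  apply: NNPP => no.
  (* Otherwise the ideal generated by g lies in the kernel of y -> p y p; being nonzero it contains
     1, but p 1 p = p is nonzero. *)
  pose sw (y : B) := p * y * p.
  have l : linear sw by move=> c x y; rewrite /sw mulrDr mulrDl -scalerAr -scalerAl.
  pose swM : {linear B -> B} := HB.pack sw (GRing.isLinear.Build _ _ _ _ sw l).
  have gI : ({:B} * <[g]> * {:B} <= lker (linfun swM))%VS.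
    apply/prodvP=> _ b /memv_cosetP[a _ ->] _; rewrite memv_ker lfunE /= /sw.
    by apply: contraT=> ab; case: no; exists a, b; rewrite !mulrA in ab.
  have idI : is_ideal ({:B} * <[g]> * {:B})%VS.
    split; first by rewrite !prodvA prodvSl // prodvSl // subvf.
    by rewrite -!prodvA prodvSr // prodvSr // subvf.
  case: (simB idI) => I0.
    have : 1 * g * 1 \in ({:B} * <[g]> * {:B})%VS.
      by rewrite !memv_mul ?memvf ?memv_line.
    by rewrite I0 memv0 mul1r mulr1 (negPf g0).
  have : 1 \in lker (linfun swM) by rewrite (subvP gI) // I0 memvf.
  by rewrite memv_ker lfunE /= /sw mulr1 pp (negPf p0).
have [z zC zE] := pBp (a * g * b).
have zp0 : z != 0.
  by apply: contraNneq abP => z0; rewrite -!mulrA in zE *; rewrite !mulrA in zE *;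
    rewrite zE z0 mul0r.
have [z' zz'] := simple_central_inv simB zC zp0.
have z'C := central_inverse zC zz'.
pose v' (i : 'I_n.+1) := if unlift ord0 i is Some j then v j else g * b * p.
(* The factor z' inverts the central z with p a g b p = z p, which normalises the new pairing to
   p. *)
pose w' (i : 'I_n.+1) := if unlift ord0 i is Some j then w j else z' * (p * a * g).
exists v', w'; split=> [i|i|i j]; rewrite /v' /w'.
- by case: unliftP => [j|] _; rewrite ?vp // -!mulrA pp.
- by case: unliftP => [j|] _; rewrite ?pw // mulrA -z'C -!mulrA [p * (p * _)]mulrA
  pp.
case: unliftP => [i'|] ->; case: unliftP => [j'|] ->.
- by rewrite wv (inj_eq (@lift_inj _ ord0)).
- by rewrite !mulrA wg !mul0r.
- by rewrite -!mulrA gv !mulr0.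
rewrite eqxx -!mulrA [g * (g * _)]mulrA gg.
by rewrite !mulrA in zE *; rewrite -!mulrA in zE *; rewrite zE mulrA -zC zz' mul1r.
Qed.

(** Systems extend until they are complete, and linear independence of the [v i] bounds their size
    by the dimension of B. *)
Lemma biorth_complete : exists n (v w : 'I_n -> B),
  biorth v w /\ \sum_i v i * w i = 1.
Proof.
suff H n : (exists n (v w : 'I_n -> B), biorth v w /\ \sum_i v i * w i = 1) \/
    exists v w : 'I_n -> B, biorth v w.
  case: (H (\dim {:B}).+1) => // [[v [w /biorth_size]]].
  by rewrite ltnn.
elim: n => [|n [|[v [w vw]]]]; [right | by left |].
  by exists (fun=> 0), (fun=> 0); split=> [[]|[]|[]].
case: (biorth_extend vw) => [s1|]; last by right.
by left; exists n, v, w.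
Qed.

(** The entry (i, j) of the image of b is the central z with w_i b v_j = z p; multiplicativity comes
    from inserting 1 = sum of the v_l w_l. *)
Lemma matrix_alg_criterion : matrix_alg_over_center B.
Proof.
have [n [v [w [[vp pw wv] vw1]]]] := biorth_complete.
have zP b i j : exists z : center_alg B, w i * b * v j == vsval z * p.
  have [z zC zE] := pBp (w i * b * v j).
  exists (Subvs (introT (mem_center z) zC)); rewrite /= -zE.
  by rewrite -{1}pw -{1}vp !mulrA.
pose phi b : 'M[center_alg B]_n := \matrix_(i, j) xchoose (zP b i j).
have phiE b i j : vsval (phi b i j) * p = w i * b * v j.
  by rewrite mxE -(eqP (xchooseP (zP b i j))).
have inj (z z' : center_alg B) : vsval z * p = vsval z' * p -> z = z'.
  move=> /eqP; rewrite -subr_eq0 -mulrBl => /eqP h; apply: val_inj; apply/eqP.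
  rewrite -subr_eq0; apply/eqP; apply: central_p0 h => a.
  by rewrite mulrBl mulrBr !center_valP.
have pa : {morph phi : a b / a - b}.
  move=> a b; apply/matrixP=> i j; apply: inj.
  rewrite phiE mulrBr mulrBl -!phiE -mulrBl -linearB; congr (vsval _ * p).
  by rewrite !mxE.
have pm : monoid_morphism phi.
  split=> [|a b]; apply/matrixP=> i j; apply: inj; rewrite phiE.
    rewrite mulr1 wv !mxE; case: (i == j);
      rewrite ?mulr1n ?mulr0n ?linear0 ?mul0r //.
    have -> : vsval (1 : center_alg B) = 1.
      by rewrite /= algid_center; apply/eqP; rewrite algid_eq1 memvf.
    by rewrite mul1r.
  rewrite [in RHS]mxE linear_sum mulr_suml -{1}[a]mulr1 -vw1 mulr_sumr mulr_suml.
  rewrite mulr_sumr mulr_suml; apply: eq_bigr => l _ /=.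
  by rewrite -[RHS]mulrA phiE -[w l in RHS]pw !mulrA phiE.
pose phM : {rmorphism B -> 'M[center_alg B]_n} := HB.pack phi
  (GRing.isZmodMorphism.Build _ _ phi pa) (GRing.isMonoidMorphism.Build _ _ phi pm).
exists n, phM; split; last first.
  move=> z; apply/matrixP=> i j; apply: inj; rewrite /= phiE.
  by rewrite -center_valP -mulrA wv mxE; case: (i == j);
    rewrite ?linear0 ?mul0r ?mulr0.
pose psi (M : 'M[center_alg B]_n) := \sum_i \sum_j vsval (M i j) * (v i * w j).
exists psi => [b | M].
  rewrite /psi /=.
  under eq_bigr => i _. under eq_bigr => j _.
    have -> : vsval (phi b i j) * (v i * w j) = v i * w i * b * (v j * w j).
      rewrite -[v i]vp -[v i * p * w j]mulrA mulrA center_valP -!mulrA [vsval _ * (p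
        * _)]mulrA phiE.
      by rewrite !mulrA vp.
    over.
    rewrite -mulr_sumr vw1 mulr1. over.
  by rewrite -mulr_suml vw1 mul1r.
apply/matrixP=> i j; apply: inj; rewrite /= phiE /psi.
have key k l : w i * (vsval (M k l) * (v k * w l)) * v j =
    vsval (M k l) * p *+ (i == k) *+ (l == j).
  rewrite mulrA -center_valP -!mulrA [w i * (v k * _)]mulrA wv wv.
  by case: (i == k); case: (l == j); rewrite ?mulr1n ?mulr0n ?mul0r ?mulr0 ?pp.
rewrite mulr_sumr mulr_suml (bigD1 i) //= [X in _ + X]big1 ?addr0 => [|k /negPf ki].
  rewrite mulr_sumr mulr_suml (bigD1 j) //= [X in _ + X]big1 ?addr0 => [|l /negPf
    lj].
    by rewrite key !eqxx.
  by rewrite key lj mulr0n.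
by rewrite mulr_sumr mulr_suml big1 // => l _; rewrite key eq_sym ki mulr0n mul0rn.
Qed.

End Criterion.

(** * Homogeneous central elements *)

Section Homogeneous.
Variables (E : falgType rat) (m k : nat).
Variables (f : {lrmorphism power E k.+1 -> power E k.+1}).
Hypothesis f_m : iter m.+1 f =1 id.
Notation R := (power E k.+1).
Notation A := (skew_alg f_m).
Notation C := (@skewC _ _ m f f_m).
Notation U := (@skewU _ _ m f f_m).

Lemma iter_mulS n (r : R) : iter (m.+1 * n) f r = r.
Proof. by rewrite -(iter_mod f_m) mulnC modnMl. Qed.

(** The period is m.+1, so f^(m i) is the inverse of f^i. *)
Lemma iter_surj i (r : R) : iter i f (iter (m * i) f r) = r.
Proof. by rewrite -iterD -mulSn iter_mulS. Qed.

Lemma skewCZ a r : C (a *: r) = a *: C r.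
Proof. by apply/ffunP=> i; rewrite !ffunE scalerMnr. Qed.
Fact skewC_is_linear : linear C.
Proof. by move=> a x y; apply/ffunP=> i; rewrite !ffunE mulrnDl scalerMnr. Qed.
HB.instance Definition _ := GRing.isLinear.Build rat R A _ C skewC_is_linear.
Lemma skewC_inj : injective C.
Proof. by move=> r r' /ffunP/(_ 0); rewrite !ffunE eqxx !mulr1n. Qed.
Lemma skewC1 : C 1 = 1.
Proof. by apply/ffunP=> i; rewrite !ffunE. Qed.

Lemma skewUX_C i r : U ^+ i * C r = C (iter i f r) * U ^+ i.
Proof.
elim: i r => [|i IH] r; first by rewrite expr0 mul1r mulr1.
by rewrite exprSr -mulrA skewU_comm mulrA IH -iterSr -mulrA.
Qed.

Lemma skewUX_mod i n : U ^+ (i + m.+1 * n) = U ^+ i.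
Proof. by rewrite exprD exprM skewUm expr1n mulr1. Qed.

(** The degree is a natural number, not a residue, so that degrees can be divided with remainder;
    [shom_mod] reduces it when needed. *)
Definition shom (x : R) (i : nat) : A := C x * U ^+ i.

Lemma shomM x i y l : shom x i * shom y l = shom (x * iter i f y) (i + l).
Proof.
by rewrite /shom mulrA -[C x * _ * _]mulrA skewUX_C mulrA -skewCM -mulrA -exprD.
Qed.
Lemma shom0 i : shom 0 i = 0. Proof. by rewrite /shom linear0 mul0r. Qed.
Lemma shom_C r : shom r 0 = C r. Proof. by rewrite /shom expr0 mulr1. Qed.
Lemma shom_mod x i n : shom x (i + m.+1 * n) = shom x i.
Proof. by rewrite /shom skewUX_mod. Qed.
Lemma shomX x i n : exists y, shom x i ^+ n = shom y (i * n).
Proof.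
elim: n => [|n [y IH]]; first by exists 1; rewrite muln0 shom_C skewC1.
by exists (x * iter i f y); rewrite exprS IH shomM mulnS.
Qed.
Lemma shom_sum (z : A) : z = \sum_(i < m.+1) shom (z i) i.
Proof. exact: skew_sumE. Qed.

Lemma mul_CE r (z : A) i : (C r * z) i = r * z i.
Proof.
rewrite ffunE (bigD1 0) //= big1 ?addr0; first by rewrite ffunE eqxx subr0.
by move=> l /negPf l0; rewrite ffunE l0 mul0r.
Qed.
Lemma mul_EC r (z : A) (i : 'I_m.+1) : (z * C r) i = z i * iter i f r.
Proof.
rewrite ffunE (bigD1 i) //= big1 ?addr0; first by rewrite ffunE subrr eqxx.
move=> l /negPf li; rewrite ffunE subr_eq0 eq_sym li mulr0n.
by rewrite iterf0 mulr0.
Qed.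

(** The two conditions under which x u^i is central: commuting with E^k, and commuting with u. *)
Definition shom_central (x : R) i :=
  (forall r, x * iter i f r = r * x) /\ f x = x.

Lemma shom_centralP x i : shom_central x i -> central (shom x i).
Proof.
case=> xr fx z; rewrite [z]shom_sum mulr_sumr mulr_suml; apply: eq_bigr => l _.
rewrite !shomM xr addnC; congr (shom (_ * _) _).
by elim: (l : nat) => //= n <-.
Qed.

Lemma central_coord (z : A) (i : 'I_m.+1) : central z -> shom_central (z i) i.
Proof.
move=> zC; split=> [r|]; first by rewrite -mul_EC zC mul_CE.
(* Commutation with u is compared in degree i + 1; [1 %% m.+1] covers the period 1, where u = 1. *)
have /ffunP/(_ (i + inord (1 %% m.+1))) := zC U; rewrite !ffunE.
rewrite (bigD1 i) //= big1 ?addr0 => [|l /negPf li]; last first.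
  rewrite ffunE subr_eq addrC (inj_eq (addrI _)) eq_sym li.
  by rewrite iterf0 mulr0.
rewrite ffunE addrC addKr eqxx iterf1 mulr1 => zi; rewrite [RHS]zi.
rewrite (bigD1 (inord (1 %% m.+1))) //= big1 ?addr0 => [|l /negPf li]; last first.
  by rewrite ffunE li mul0r.
by rewrite ffunE eqxx mul1r addrK inordK ?ltn_mod // (iter_mod f_m).
Qed.

Lemma central_shom x i : central (shom x i) -> shom_central x i.
Proof.
move=> hC; have := @central_coord _ (inord (i %% m.+1)) hC.
rewrite /shom skewCUE eqxx mulr1n => -[xr fx]; split=> // r.
by rewrite -(iter_mod f_m) -(xr r) inordK ?ltn_mod.
Qed.

End Homogeneous.

(** * The action of the powers of f on one copy of E *)

Section Component.
Variables (E : falgType rat) (simpleE : simple_alg E).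
Variables (star : {linear E -> E}) (star_pos : positive_involution star).
Variables (m k : nat) (f : {lrmorphism power E k.+1 -> power E k.+1}).
Hypothesis f_star : forall x, f (powmap star x) = powmap star (f x).
Hypothesis f_m : iter m.+1 f =1 id.
Variable j : 'I_k.+1.
Notation R := (power E k.+1).
Notation ps := (@powmap E k.+1 star).

Lemma star1 : star 1 = 1.
Proof. by rewrite -[LHS]mulr1 -{2}[1](starK star_pos) -(starM star_pos) mulr1 (starK
  star_pos). Qed.

Lemma star_central c : central c -> central (star c).
Proof.
by move=> cC a; rewrite -[a](starK star_pos) -!(starM star_pos) cC.
Qed.

Lemma mulr_star_neq0 x : x != 0 -> x * star x != 0.
Proof.
case: star_pos => _ _ h x0; apply/eqP=> xx.
by have := h x x0; rewrite xx linear0 ltxx.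
Qed.

Lemma central_unit (c : E) : central c -> c != 0 -> exists2 c', central c' & c * c'
  = 1.
Proof.
move=> cC c0; have [c' cc'] := simple_central_inv simpleE cC c0.
by exists c' => //; apply: central_inverse cc'.
Qed.

Definition incl (r : E) : R := [ffun i => r *+ (i == j)].

Lemma inclE r : incl r j = r. Proof. by rewrite ffunE eqxx. Qed.
Fact incl_is_linear : linear incl.
Proof. by move=> a x y; apply/ffunP=> i; rewrite !ffunE mulrnDl scalerMnr. Qed.
HB.instance Definition _ := GRing.isLinear.Build rat E R _ incl incl_is_linear.
Lemma inclM r r' : incl (r * r') = incl r * incl r'.
Proof.
apply/ffunP=> i; rewrite !ffunE; case: (i == j); rewrite ?mulr1n //.
by rewrite !mulr0n mul0r.
Qed.
Lemma incl_mull r (x : R) : incl r * x = incl (r * x j).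
Proof.
apply/ffunP=> i; rewrite !ffunE; have [->|_] := eqVneq i j; rewrite ?mulr1n //.
by rewrite !mulr0n mul0r.
Qed.
Lemma incl_mulr r (x : R) : x * incl r = incl (x j * r).
Proof.
apply/ffunP=> i; rewrite !ffunE; have [->|_] := eqVneq i j; rewrite ?mulr1n //.
by rewrite !mulr0n mulr0.
Qed.
Lemma incl_star r : incl (star r) = ps (incl r).
Proof. by apply/ffunP=> i; rewrite !ffunE linearMn. Qed.
Lemma incl_central c : central c -> central (incl c).
Proof. by move=> cC x; rewrite incl_mull incl_mulr cC. Qed.

(* A ring endomorphism of the j-th copy of E when f^i fixes that copy, and 0
   otherwise. *)
Definition corner (i : nat) (r : E) : E := iter i f (incl r) j.

Fact corner_is_linear i : linear (corner i).
Proof. by move=> a x y; rewrite /corner linearP iter_linear !ffunE. Qed.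
HB.instance Definition _ i := GRing.isLinear.Build rat E E _ (corner i)
  (corner_is_linear i).

Lemma cornerM i r r' : corner i (r * r') = corner i r * corner i r'.
Proof. by rewrite /corner inclM iterf_mul ffunE. Qed.
Lemma corner_id r : corner 0 r = r. Proof. exact: inclE. Qed.
Lemma corner_star i r : corner i (star r) = star (corner i r).
Proof. by rewrite /corner incl_star (iter_ps f_star) ffunE. Qed.

Lemma iter_central i (x : R) : central x -> central (iter i f x).
Proof. by move=> xC a; rewrite -[a](iter_surj f_m i) -!iterf_mul xC. Qed.
Lemma coord_central (x : R) l : central x -> central (x l).
Proof.
move=> xC a; have /ffunP/(_ l) := xC [ffun=> a].
by rewrite !ffunE.
Qed.
Lemma corner_central i c : central c -> central (corner i c).
Proof. by move=> cC; apply: coord_central; apply: iter_central;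
  apply: incl_central. Qed.

(** [corner i 1] is a central idempotent of the simple algebra E. *)
Lemma corner1_cases i : corner i 1 = 0 \/ corner i 1 = 1.
Proof.
have [|c0] := eqVneq (corner i 1) 0; [by left | right].
have [c' _ cc'] := central_unit (corner_central i (@central1 E)) c0.
have cc : corner i 1 * corner i 1 = corner i 1 by rewrite -cornerM mulr1.
by rewrite -[RHS]cc' -[in RHS]cc -mulrA cc' mulr1.
Qed.

(** The stabiliser of j for the permutation of the k.+1 copies of E induced by f, as a set of
    exponents. *)
Definition stab i := corner i 1 = 1.

Lemma stab_iter i (x : R) : stab i -> iter i f x j = corner i (x j).
Proof.
move=> iS; rewrite -[LHS]mul1r -{1}iS /corner.
by rewrite -[x j]mul1r -incl_mull iterf_mul [in RHS]ffunE.
Qed.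
Lemma cornerD i l r : stab i -> corner (i + l) r = corner i (corner l r).
Proof. by move=> iS; rewrite /corner iterD stab_iter. Qed.
Lemma stab0 : stab 0. Proof. exact: corner_id. Qed.
Lemma stabD i l : stab i -> stab l -> stab (i + l).
Proof. by move=> iS lS; rewrite /stab cornerD // lS. Qed.
Lemma stabB i l : stab i -> stab (i + l) -> stab l.
Proof.
move=> iS; rewrite {1}/stab cornerD //; case: (corner1_cases l) => // ->.
by rewrite linear0 => /eqP; rewrite eq_sym oner_eq0.
Qed.
Lemma stabM i n : stab i -> stab (i * n).
Proof.
move=> iS; elim: n => [|n IH]; first by rewrite muln0; apply: stab0.
by rewrite mulnS; apply: stabD.
Qed.
Lemma corner_mulS n r : corner (m.+1 * n) r = r.
Proof. by rewrite /corner (iter_mulS f_m) inclE. Qed.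
Lemma corner_surj i r : stab i -> corner i (corner (m * i) r) = r.
Proof. by move=> iS; rewrite -cornerD // -mulSn corner_mulS. Qed.

Section HomCentral.
Variables (x : R) (i : nat).
Hypotheses (xC : shom_central f x i) (x0 : x j != 0).

Lemma shom_central_stab : stab i.
Proof.
case: (corner1_cases i) => // h; case/negP: x0.
have /ffunP/(_ j) := xC.1 (incl 1); rewrite !ffunE -/(corner i 1) h mulr0.
by rewrite eqxx mulr1n mul1r => <-.
Qed.
Lemma shom_central_comm r : x j * corner i r = r * x j.
Proof.
by have /ffunP/(_ j) := xC.1 (incl r); rewrite !ffunE eqxx mulr1n.
Qed.
Lemma shom_central_fix l : stab l -> corner l (x j) = x j.
Proof.
by move=> lS; rewrite -stab_iter //; congr fun_of_fin; elim: (l) => //= n ->;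
  apply: xC.2.
Qed.
(** With x = [x j], centrality gives r x = x corner(r), and applying star gives corner(r) star(x) =
    star(x) r. *)
Lemma shom_central_norm : central (x j * star (x j)).
Proof.
move=> r; rewrite mulrA -shom_central_comm -!mulrA; congr (_ * _).
rewrite -[RHS](starK star_pos) (starM star_pos) (starK star_pos) -corner_star.
by rewrite shom_central_comm (starM star_pos) (starK star_pos).
Qed.
(** [x j] kills the central element [corner i c - c], which is invertible unless it is zero. *)
Lemma shom_central_corner c : central c -> corner i c = c.
Proof.
move=> cC; apply/eqP; rewrite -subr_eq0; apply/contraT=> d0.
have dC : central (corner i c - c).
  by apply: centralD; [apply: corner_central | apply: centralN].
have [d' _ dd'] := central_unit dC d0.
case/negP: x0; rewrite -[x j]mulr1 -dd' mulrA mulrBr shom_central_comm cC subrr.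
by rewrite mul0r.
Qed.
End HomCentral.

End Component.

Lemma idempotent_field (M : fieldType) (x : M) : x * x = x -> x != 0 -> x = 1.
Proof. by move=> xx x0; apply: (mulfI x0); rewrite mulr1. Qed.

(** * A field containing the images of both centers *)

Section Bicommutant.
Variables (E : falgType rat).
Variables (star : {linear E -> E}) (star_pos : positive_involution star).
Variables (m k : nat) (f : {lrmorphism power E k.+1 -> power E k.+1}).
Hypothesis f_star : forall x, f (powmap star x) = powmap star (f x).
Hypothesis f_m : iter m.+1 f =1 id.
Notation R := (power E k.+1).
Notation A := (skew_alg f_m).
Notation C := (@skewC _ _ m f f_m).
Notation U := (@skewU _ _ m f f_m).
Notation ps := (@powmap E k.+1 star).
Notation st := (@skew_star E star m k f f_m).
Notation posT := (@skew_pos_trace E star star_pos m k f f_star f_m).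

Let stM x y : st (x * y) = st y * st x.
Proof. exact: (skew_starM star_pos f_star). Qed.
Let stK : involutive st.
Proof. exact: (skew_starK star_pos f_star). Qed.

Lemma skew_star_C r : st (C r) = C (ps r).
Proof.
apply/ffunP=> i; rewrite !ffunE oppr_eq0; have [->|_] := eqVneq i 0;
  rewrite ?mulr1n //.
by rewrite !mulr0n linear0 iterf0.
Qed.

Lemma mul_U_star : U * st U = 1.
Proof.
apply/ffunP=> l; rewrite ffunE (bigD1 (inord (1 %% m.+1))) //=.
rewrite big1 ?addr0 => [|i /negPf i1]; last by rewrite ffunE i1 mul0r.
rewrite !ffunE eqxx mul1r.
have -> : (- (l - inord (1 %% m.+1)) == inord (1 %% m.+1) :> 'I_m.+1) = (l == 0).
  by rewrite opprB -[X in _ == X]subr0 (inj_eq (addrI _)) eqr_opp.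
have ps1 : ps 1 = 1 by apply/ffunP=> i; rewrite !ffunE (star1 star_pos).
case: eqP => [->|_]; last by rewrite mulr0n linear0 !iterf0.
by rewrite sub0r ps1 !iterf1.
Qed.

Lemma skew_star_U : st U = U ^+ m.
Proof.
by rewrite -[LHS]mul1r -[1](skewUm f_m) exprSr -mulrA mul_U_star mulr1.
Qed.

Lemma skew_starX (x : A) n : st (x ^+ n) = st x ^+ n.
Proof.
elim: n => [|n IH]; first exact: (pos_trace_st1 posT).
by rewrite exprS exprSr stM IH.
Qed.

Lemma skew_star_shom x i :
  st (shom f_m x i) = shom f_m (iter (m * i) f (ps x)) (m * i).
Proof.
rewrite /shom stM skew_starX skew_star_U skew_star_C -exprM.
exact: skewUX_C.
Qed.

Lemma shom_norm x i : shom f_m x i * st (shom f_m x i) = C (x * ps x).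
Proof.
rewrite skew_star_shom shomM (iter_surj f_m) -mulSn -[(_ * i)%N]add0n shom_mod.
exact: shom_C.
Qed.

Lemma star_central_skew z : central z -> central (st z).
Proof.
by move=> zC a; rewrite -[a]stK -!stM zC.
Qed.

Definition base_cent : {aspace A} := 'C(limg (linfun C))%AS.
(** Taking the center of the centralizer makes it commutative by construction, while it still
    contains the center of A and that of E^k. *)
Definition bicomm : {aspace A} := 'Z(base_cent)%AS.

Lemma base_centP x : reflect (forall r, x * C r = C r * x) (x \in base_cent).
Proof.
apply: (iffP idP) => [/centvP h r | h]; last first.
  by apply/centvP=> _ /memv_imgP[r _ ->]; rewrite lfunE; apply: h.
by apply: h; have := memv_img (linfun C) (memvf r); rewrite lfunE.
Qed.

Lemma bicommP x : reflect
  ((forall r, x * C r = C r * x) /\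
   forall y, (forall r, y * C r = C r * y) -> x * y = y * x) (x \in bicomm).
Proof.
rewrite memv_cap; apply: (iffP andP) => [[/base_centP h /centvP h']|[h h']].
  by split=> // y /base_centP; apply: h'.
by split; [apply/base_centP | apply/centvP=> y /base_centP; apply: h'].
Qed.

Lemma sum_incl1 : \sum_j C (incl j 1) = 1 :> A.
Proof.
rewrite -linear_sum -(skewC1 f_m); congr (C _); apply/ffunP=> l.
rewrite sum_ffunE (bigD1 l) //= big1 ?addr0 => [|t /negPf tl].
  by rewrite !ffunE eqxx.
by rewrite ffunE eq_sym tl.
Qed.

Lemma bicomm1 : 1 \in bicomm.
Proof. by apply/bicommP; split=> [r|y _]; rewrite mul1r mulr1. Qed.
Lemma bicomm_central z : central z -> z \in bicomm.
Proof. by move=> zC; apply/bicommP; split=> [r|y _]; rewrite zC. Qed.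
Lemma bicomm_C r : central r -> C r \in bicomm.
Proof.
move=> rC; apply/bicommP; split=> [r'|y yC]; last by rewrite yC.
by rewrite -!skewCM rC.
Qed.
Lemma bicomm_comm : {in bicomm &, forall x y, x * y = y * x}.
Proof. by move=> x y /bicommP[_ h] /bicommP[h' _]; apply: h. Qed.
Lemma bicomm_star x : x \in bicomm -> st x \in bicomm.
Proof.
have stC y : (forall r, y * C r = C r * y) -> forall r, st y * C r = C r * st y.
  move=> yC r; rewrite -[C r]stK -!stM.
  by rewrite skew_star_C yC.
case/bicommP=> xC xD; apply/bicommP; split=> [|y /stC yC]; first exact: stC.
by rewrite -[y]stK -!stM xD.
Qed.

(* [q] sends the bicommutant of E^k to a field; it plays the role of a field
   containing both the factor L of the center and, through the j-th coordinate,
   the center of E. *)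
Definition field_char (M : fieldExtType rat) (q : {linear A -> M}) (j : 'I_k.+1) :=
  [/\ q 1 = 1, {in bicomm &, forall x y, q (x * y) = q x * q y}
    & q (C (incl j 1)) = 1].

Lemma field_char_exists (e : A) : central e -> e * e = e -> e != 0 ->
  exists (M : fieldExtType rat) (q : {linear A -> M}) (j : 'I_k.+1),
    field_char q j /\ q e = 1.
Proof.
move=> eC ee e0.
have posW := sub_pos_trace posT bicomm_star.
have comW : commutative (@GRing.mul (subvs_of bicomm)).
  by move=> x y; apply: val_inj; apply: bicomm_comm; apply: subvsP.
have [n [L [pi [io [ioK pi_io sum_io]]]]] := comm_pos_fields posW comW.
have eW := bicomm_central eC.
have pe : vsval (vsproj bicomm e) = e by rewrite vsprojK.
have [i pie] : exists i, pi i (vsproj bicomm e) != 0.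
  apply: NNPP => no; case/negP: e0; rewrite -pe.
  rewrite (factors_inj sum_io (z := vsproj bicomm e)) //= => i.
  by apply/eqP/contraT => h; case: no; exists i.
(* Precomposing with [vsproj bicomm] extends the factor map linearly to A; multiplicativity is
   established only on [bicomm]. *)
have ql : linear (pi i \o vsproj bicomm) by move=> a x y; rewrite /= !linearP.
pose q : {linear A -> L i} := HB.pack (pi i \o vsproj bicomm)
  (GRing.isLinear.Build _ _ _ _ (pi i \o vsproj bicomm) ql).
have q1 : q 1 = 1.
  rewrite /= -(rmorph1 (pi i)); congr (pi i _); apply: val_inj.
  by rewrite /= vsprojK ?bicomm1 //; apply/esym/vsval1/bicomm1.
have qM : {in bicomm &, forall x y, q (x * y) = q x * q y}.
  move=> x y xW yW; rewrite /= -rmorphM; congr (pi i _); apply: val_inj.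
  by rewrite /= !vsprojK // memvM.
(* The coordinate idempotents add up to 1, so one of them has nonzero image, necessarily 1 in a
   field. *)
have [j qj] : exists j, q (C (incl j 1)) != 0.
  apply: NNPP => no; have := oner_neq0 (L i); rewrite -q1.
  rewrite -sum_incl1.
  rewrite linear_sum big1 ?eqxx // => j _.
  by apply/eqP/contraT => h; case: no; exists j.
exists (L i), q, j; split; first split=> //.
  have jW : C (incl j 1) \in bicomm by apply/bicomm_C/incl_central/central1.
  by apply: idempotent_field qj; rewrite -qM // -skewCM -inclM mulr1.
apply: idempotent_field; last by rewrite /= in pie *.
by rewrite -qM // ee.
Qed.

End Bicommutant.

(** * Factors of the center fixed by the involution *)

Lemma least_nat (P : nat -> Prop) : (exists n, P n) ->
  exists2 n, P n & forall i, (i < n)%N -> ~ P i.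
Proof.
case=> n; elim/ltn_ind: n => n IH Pn.
case: (classic (exists2 i, (i < n)%N & P i)) => [[i lin Pi] | no];
  first exact: IH Pi.
by exists n => // i lin Pi; apply: no; exists i.
Qed.

Section Character.
Variables (E : falgType rat) (simpleE : simple_alg E).
Variables (star : {linear E -> E}) (star_pos : positive_involution star).
Variables (m k : nat) (f : {lrmorphism power E k.+1 -> power E k.+1}).
Hypothesis f_star : forall x, f (powmap star x) = powmap star (f x).
Hypothesis f_m : iter m.+1 f =1 id.
Notation R := (power E k.+1).
Notation A := (skew_alg f_m).
Notation C := (@skewC _ _ m f f_m).
Notation ps := (@powmap E k.+1 star).
Notation st := (@skew_star E star m k f f_m).
Variables (M : fieldExtType rat) (q : {linear A -> M}) (j : 'I_k.+1).
Hypothesis qP : field_char q j.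
Hypothesis qst : forall z, central z -> q (st z) = q z.
Notation corner := (corner f j).

Definition base_char (c : E) : M := q (C (incl j c)).
Local Notation b := base_char.

Fact base_char_is_linear : linear b.
Proof. by move=> a x y; rewrite /b !linearP. Qed.
HB.instance Definition _ := GRing.isLinear.Build rat E M _ b base_char_is_linear.

Lemma q_mul x y : x \in bicomm f_m -> y \in bicomm f_m -> q (x * y) = q x * q y.
Proof. by case: qP => _ qM _; apply: qM. Qed.
Lemma base_char1 : b 1 = 1. Proof. by case: qP. Qed.
Lemma incl_bicomm c : central c -> C (incl j c) \in bicomm f_m.
Proof. by move=> cC; apply/bicomm_C/incl_central. Qed.
Lemma base_charM c d : central c -> central d -> b (c * d) = b c * b d.
Proof. by move=> cC dC; rewrite /b inclM skewCM q_mul ?incl_bicomm. Qed.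
Lemma base_charX c n : central c -> b (c ^+ n) = b c ^+ n.
Proof.
move=> cC; elim: n => [|n IH]; first by rewrite !expr0 base_char1.
by rewrite !exprS base_charM ?IH //; apply: centralX.
Qed.
Lemma base_char_eq0 c : central c -> b c = 0 -> c = 0.
Proof.
move=> cC bc; apply/eqP/contraT=> c0.
have [c' c'C cc'] := central_unit simpleE cC c0.
have := oner_neq0 M; rewrite -base_char1 -cc' base_charM // bc mul0r.
by rewrite eqxx.
Qed.
Lemma base_char_inj c d : central c -> central d -> b c = b d -> c = d.
Proof.
move=> cC dC /eqP; rewrite -subr_eq0 -linearB => /eqP h.
by apply/eqP; rewrite -subr_eq0; apply/eqP/base_char_eq0=> //;
  apply/centralD/centralN.
Qed.

Lemma q_base r : central r -> q (C r) = b (r j).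
Proof.
move=> rC; rewrite -[LHS]mul1r -base_char1 -q_mul ?incl_bicomm //; last 2 first.
- exact: central1.
- exact: bicomm_C.
by rewrite -skewCM incl_mull mul1r.
Qed.

Lemma q_centralX z n : central z -> q (z ^+ n) = q z ^+ n.
Proof.
move=> zC; elim: n => [|n IH]; first by rewrite !expr0; case: qP.
rewrite !exprS q_mul ?IH //; first exact: bicomm_central.
exact/bicomm_central/centralX.
Qed.

Lemma C_central r : central (C r) -> central r.
Proof. by move=> rC a; apply: (@skewC_inj _ _ _ _ f_m); rewrite !skewCM rC. Qed.

Section Shom.
Variables (x : R) (i : nat).
Hypothesis xC : shom_central f x i.
Notation h := (shom f_m x i).

Lemma shom_bicomm : h \in bicomm f_m.
Proof. exact/bicomm_central/shom_centralP. Qed.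

Lemma q_shom0 : x j = 0 -> q h = 0.
Proof.
move=> x0; rewrite -[LHS]mul1r -base_char1 -q_mul ?incl_bicomm ?shom_bicomm //;
  last first.
  exact: central1.
by rewrite /shom mulrA -skewCM incl_mull mul1r x0 linear0 linear0 mul0r linear0.
Qed.

(** One of the two factors h may be replaced by its star by [qst], and the powers of u then
    cancel. *)
Lemma q_shom_norm : q h ^+ 2 = b (x j * star (x j)).
Proof.
have hC := shom_centralP (f_m := f_m) xC.
rewrite expr2 -{2}qst // -q_mul ?shom_bicomm //; last first.
  exact/(bicomm_star star_pos f_star)/shom_bicomm.
rewrite (shom_norm star_pos f_star) q_base ?ffunE //.
apply: C_central; rewrite -(shom_norm star_pos f_star f_m x i).
by apply: centralM => //; apply: (star_central_skew star_pos f_star).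
Qed.

Lemma q_shom_neq0 : x j != 0 -> q h != 0.
Proof.
move=> x0; apply/eqP=> qh; have := q_shom_norm; rewrite qh expr0n => /esym.
move/base_char_eq0 => /(_ (shom_central_norm star_pos f_star j xC)) /eqP.
by rewrite (negPf (mulr_star_neq0 star_pos x0)).
Qed.

Lemma q_shomX_mem : exists2 c, central c & q h ^+ m.+1 = b c.
Proof.
have hC := shom_centralP (f_m := f_m) xC.
have [y hy] := shomX f_m x i m.+1.
have hyC : h ^+ m.+1 = C y.
  by rewrite hy mulnC -[(_ * _)%N]add0n shom_mod shom_C.
have yC : central y by apply: C_central; rewrite -hyC; apply: centralX.
exists (y j); first exact: coord_central.
by rewrite -q_base // -hyC q_centralX.
Qed.

Lemma q_shom_odd : odd m.+1 -> exists2 c, central c & q h = b c.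
Proof.
move=> mo; have [x0|x0] := eqVneq (x j) 0.
  by exists 0; [apply: central0 | rewrite q_shom0 // linear0].
have lC := shom_central_norm star_pos f_star j xC.
have [l' l'C ll'] := central_unit simpleE lC (mulr_star_neq0 star_pos x0).
have [c cC hc] := q_shomX_mem.
(* For y = q h and m.+1 = 2 r + 1, y = y^(m.+1) (y^2)^(-r), where y^2 is the image of the norm with
   inverse l'. *)
exists (c * l' ^+ m.+1./2); first by apply: centralM => //; apply: centralX.
rewrite base_charM ?base_charX //; last exact: centralX.
have qo (y : M) : y ^+ m.+1 = y * (y ^+ 2) ^+ m.+1./2.
  by rewrite -exprM mul2n -exprS -[in LHS](odd_double_half m.+1) mo.
rewrite -hc qo q_shom_norm.
by rewrite -mulrA -exprMn -base_charM // ll' base_char1 expr1n mulr1.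
Qed.
End Shom.

Lemma q_central_mem : (forall x i, shom_central f x i ->
    exists2 c, central c & q (shom f_m x i) = b c) ->
  forall z, central z -> exists2 c, central c & q z = b c.
Proof.
move=> H z zC; rewrite [z](shom_sum) linear_sum.
apply: (big_ind (fun y => exists2 c, central c & y = b c)) => [|_ _ [c cC ->] [d dC
  ->]|i _].
- by exists 0; [apply: central0 | rewrite linear0].
- by exists (c + d); [apply: centralD | rewrite linearD].
by apply: H; apply: central_coord.
Qed.

(* The sum of the f-conjugates of c is central in E^k[m, f], hence fixed by the
   involution after applying q. *)
Lemma base_char_rel c : central c ->
  \sum_(i < m.+1) b (star (corner i c)) = \sum_(i < m.+1) b (corner i c).
Proof.
move=> cC; pose r : R := \sum_(i < m.+1) iter i f (incl j c).
have rC : central r.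
  by apply: central_sum => i _; apply: (iter_central f_m); apply: incl_central.
have fr : f r = r.
  rewrite /r linear_sum big_ord_recr [RHS]big_ord_recl /= addrC; congr (_ + _).
  exact: f_m.
have hC : central (C r).
  rewrite -shom_C; apply: shom_centralP; split=> //.
have := qst hC; rewrite (skew_star_C) !q_base //; last first.
  by move=> a; rewrite -[a](psK star_pos) -!(psM star_pos) rC.
by rewrite ffunE /r sum_ffunE !linear_sum.
Qed.

(** If no power of f induced star, the character [b \o star] would be distinct from all others in
    [base_char_rel]. Its multiplicity N is then zero in M, although the exponent 0 contributes to it
    and the characteristic is 0. *)
Lemma corner_star_exists : exists l, forall c, central c -> corner l c = star c.
Proof.
apply: NNPP => no.
pose cb := vbasis 'Z({:E}).
have cbC v : v \in cb -> central v by move=> /vbasis_mem /mem_center.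
(* Testing on a basis makes triviality of [corner i] on the center a boolean. *)
pose pb i := all (fun v => corner i v == v) cb.
have pbP i : pb i -> forall c, central c -> corner i c = c.
  move=> /allP pi c /mem_center/coord_vbasis ->; rewrite linear_sum;
    apply: eq_bigr => t _.
  rewrite linearZ /=.
  by have /pi/eqP -> : (vbasis 'Z({:E}))`_t \in cb by rewrite memt_nth.
pose X := center_alg E.
have XC (c : X) : central (vsval c) by apply/mem_center/subvsP.
pose chi (c : X) := b (star (vsval c)).
(* The relation is solved for N chi: first the terms without star, with coefficient 1, then those
   with star, with coefficient -1. The latter equal chi when [corner i] is trivial on the center;
   these are counted in N and replaced by 0. *)
pose s i (c : X) := if (i < m.+1)%N then b (corner i (vsval c)) else
  if pb (i - m.+1)%N then 0 else b (star (corner (i - m.+1) (vsval c))).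
pose a (i : nat) : M := if (i < m.+1)%N then 1 else -1.
pose N := (\sum_(i < m.+1) pb i)%N.
have cC i (c : X) : central (corner i (vsval c)) by apply: (corner_central f_m).
have sC (c : E) : central c -> central (star c) by apply: (star_central star_pos).
have N0 : N%:R = 0 :> M.
  apply: (@dedekind_independence X M chi s (m.+1 + m.+1) a).
  - rewrite /chi; have -> : vsval (1 : X) = 1 by apply/vsval1/mem_center/central1.
    by rewrite (star1 star_pos) base_char1.
  - move=> c d; rewrite /chi /= (starM star_pos) base_charM;
    [exact: mulrC | exact: sC | exact: sC].
  - move=> i c d; rewrite /s; case: ifP => _; first by rewrite /= cornerM base_charM.
    case: ifP => _; first by rewrite mul0r.
    by rewrite /= cornerM (starM star_pos) base_charM;
      [exact: mulrC | exact: sC | exact: sC].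
  - move=> i _; rewrite /s; case: (i < m.+1)%N.
      apply: NNPP => no'; apply: no; exists i => c cCe; apply: NNPP => ne.
      apply: no'; exists (Subvs (introT (mem_center c) cCe)) => /base_char_inj.
      by move=> h; apply: ne; apply/esym/h;
        [apply: sC | apply: (corner_central f_m)].
    case pbi: (pb (i - m.+1)%N); last move/negbT: pbi.
      exists 1; rewrite /chi; have -> : vsval (1 : X) = 1 by
        apply/vsval1/mem_center/central1.
      by rewrite (star1 star_pos) base_char1; apply/eqP/oner_neq0.
    move/allPn=> [v vb vP].
    exists (Subvs (introT (mem_center v) (cbC v vb))) => /base_char_inj /= h.
    case/negP: vP; rewrite -(can_eq (starK star_pos)) eq_sym; apply/eqP/h.
      exact/sC/cbC.
    exact/sC/(corner_central f_m)/cbC.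
  move=> c; have := base_char_rel (XC c).
  rewrite big_split_ord /=.
  under [X in _ -> _ = X + _]eq_bigr => i _ do rewrite /a /s ltn_ord mul1r.
  under [X in _ -> _ = _ + X]eq_bigr => i _ do rewrite /a /s ltnNge leq_addr /=
    addKn mulN1r.
  move=> <-; rewrite -big_split /= natr_sum mulr_suml; apply: eq_bigr => i _.
  case: ifP => [pi|_]; last by rewrite mul0r subrr.
  by rewrite (pbP _ pi) // mul1r subr0.
have := N0; rewrite -scaler_nat => /eqP.
rewrite scaler_eq0 oner_eq0 orbF pnatr_eq0 /N big_ord_recl.
suff -> : pb 0 by [].
by apply/allP=> v _; rewrite corner_id.
Qed.

Lemma stab_corner_star l : (forall c, central c -> corner l c = star c) -> stab f j
  l.
Proof. by move=> lP; rewrite /stab lP ?(star1 star_pos) //; apply: central1. Qed.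

(* The powers of f acting on the j-th copy induce a cyclic group on the center
   of E containing star; for the least l inducing star, those acting trivially
   are the multiples of 2 l. *)
Lemma corner_star_least : (exists2 c : E, central c & star c <> c) ->
  exists2 l, (forall c, central c -> corner l c = star c) &
    forall i, stab f j i -> (forall c, central c -> corner i c = c) -> (2 * l %|
      i)%N.
Proof.
case=> c0 c0C c0P.
have [l lP lmin] := least_nat corner_star_exists; exists l => // i iS iP.
have lS := stab_corner_star lP.
have cC p c : central c -> central (corner p c) by apply: (corner_central f_m).
have l0 : (0 < l)%N.
  case: (posnP l) => // l0; case: c0P; rewrite -lP // l0; exact: corner_id.
have llS n : stab f j (2 * l * n) by apply/stabM; rewrite mul2n -addnn; apply: stabD.
have ll n c : central c -> corner (2 * l * n) c = c.
  elim: n c => [|n IH] c cCe; first by rewrite muln0 corner_id.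
  rewrite mulnS cornerD; last by rewrite mul2n -addnn; apply: stabD.
  rewrite IH // mul2n -addnn cornerD // !lP //; first exact: (starK star_pos).
  exact: (star_central star_pos).
set r := (i %% (2 * l))%N.
have rS : stab f j r.
  by apply: (stabB simpleE f_m (llS (i %/ (2 * l))%N)); rewrite mulnC -divn_eq.
have rP c : central c -> corner r c = c.
  move=> cCe; rewrite -[LHS](ll (i %/ (2 * l))%N _ (cC r c cCe)) -cornerD //.
  by rewrite mulnC -divn_eq iP.
have rl : (r < 2 * l)%N by rewrite ltn_mod muln_gt0.
rewrite /dvdn -/r; apply/eqP; case: (posnP r) => // r0; exfalso.
(* As star is its own inverse, 0 < r < 2 l would make r - l or l - r a smaller exponent inducing
   star. *)
have [lr|rltl] := leqP l r.
  apply: (lmin (r - l)%N); first by rewrite ltn_subLR // addnn -mul2n.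
  move=> c cCe; have rE : r = (l + (r - l))%N by rewrite subnKC.
  have := rP c cCe; rewrite {1}rE cornerD // lP; last exact: cC.
  by move/(congr1 star); rewrite (starK star_pos).
have lE : l = (r + (l - r))%N by rewrite subnKC // ltnW.
apply: (lmin (l - r)%N); first by rewrite ltn_subrL r0 l0.
move=> c cCe; have := lP c cCe; rewrite {1}lE cornerD // rP //; exact: cC.
Qed.

Section MatrixCase.
Variables (K : fieldType) (d : nat).
Variables (Phi : {rmorphism E -> 'M[K]_d.+1}) (Psi : {rmorphism 'M[K]_d.+1 -> E}).
Hypotheses (PhiK : cancel Phi Psi) (PsiK : cancel Psi Phi).
Hypothesis star_nontriv : exists2 c : E, central c & star c <> c.

Lemma Psi_scalar_central c : central (Psi c%:M).
Proof.
move=> a; rewrite -[a]PhiK -!rmorphM; congr (Psi _); exact: mulr_scalar_mxC.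
Qed.

Lemma Phi_central c : central c -> exists a, Phi c = a%:M.
Proof.
move=> cC; apply: cent_scalar_mx => Y.
by rewrite -[Y]PsiK -!rmorphM cC.
Qed.

Lemma corner_matrix p : stab f j p ->
  exists H : {rmorphism 'M[K]_d.+1 -> 'M[K]_d.+1}, forall X, H X = Phi (corner p
    (Psi X)).
Proof.
move=> pS; pose H X := Phi (corner p (Psi X)).
have Ha : {morph H : X Y / X - Y} by move=> X Y; rewrite /H !raddfB.
have Hm : monoid_morphism H.
  split=> [|X Y]; first by rewrite /H rmorph1 pS rmorph1.
  by rewrite /H rmorphM cornerM rmorphM.
by exists (HB.pack_for {rmorphism 'M[K]_d.+1 -> 'M[K]_d.+1} H
  (GRing.isZmodMorphism.Build _ _ H Ha) (GRing.isMonoidMorphism.Build _ _ H Hm)).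
Qed.

Lemma norm_square x i : shom_central f x i -> x j != 0 ->
  exists2 c, central c & x j * star (x j) = c * c.
Proof.
move=> xC x0.
have iS := shom_central_stab simpleE f_m xC x0.
have iP := shom_central_corner simpleE f_m xC x0.
have [l lP /(_ i iS iP) /dvdnP[n iE]] := corner_star_least star_nontriv.
have lS := stab_corner_star lP.
have pS : stab f j (l * n) by apply: stabM.
have ipp : i = (l * n + l * n)%N by rewrite iE addnn -mul2n mulnC -mulnA [(l *
  n)%N]mulnC [(n * l)%N]mulnC.
pose S X := Phi (star (Psi X)).
have Sa : {morph S : X Y / X - Y} by move=> X Y; rewrite /S !raddfB.
pose SM : {additive 'M[K]_d.+1 -> 'M[K]_d.+1} := HB.pack S
  (GRing.isZmodMorphism.Build _ _ S Sa).
have SMm X Y : SM (X * Y) = SM Y * SM X.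
  by rewrite /= /S rmorphM (starM star_pos) rmorphM.
have SK : involutive SM by move=> X; rewrite /= /S PhiK (starK star_pos) PsiK.
have cC := Psi_scalar_central.
have [H HE] := corner_matrix pS; have [h hE] := corner_matrix lS.
have xHH X : Phi (x j) * H (H X) = X * Phi (x j).
  rewrite !HE PhiK -cornerD // -ipp -rmorphM (shom_central_comm _ xC) rmorphM.
  by rewrite PsiK.
have HS X : H (SM X) = SM (H X) by rewrite !HE /= /S !PhiK (corner_star f_star).
have fixx p : stab f j p -> corner p (x j) = x j by apply: (shom_central_fix xC).
suff [c cE] : exists c, Phi (x j) * SM (Phi (x j)) = (c ^+ 2)%:M.
  exists (Psi c%:M) => //; apply: (can_inj PhiK).
  rewrite !rmorphM PsiK -mulmxE -scalar_mxM -expr2 mulmxE.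
  by rewrite -cE /= /S PhiK.
have sC c : central (star (Psi c%:M)) by apply: (star_central star_pos).
have pn : (forall c, central c -> corner (l * n) c = if odd n then star c else c).
  elim: (n) => [|n' IH] c cCe; first by rewrite muln0 corner_id.
  rewrite mulnS cornerD // IH // lP /=; last by case: ifP => // _;
    apply: (star_central star_pos).
  by case: (odd n'); rewrite //= (starK star_pos).
(* On scalars [corner (l * n)] induces star for odd n and the identity for even n. In the even case
   [corner l] serves as the semilinear map commuting with it. *)
case: (boolP (odd n)) => no.
  apply: (norm_square_semilinear SMm SK (h := H)) => // [c|].
    by rewrite HE /= /S PhiK pn // no (starK star_pos) PsiK.
  by rewrite HE PhiK fixx.
apply: (norm_square_linear SMm SK (h := h) (g := H)) => // [X|X|c|c|].
- exists (Phi (corner (m * l) (Psi X))); rewrite hE PhiK.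
  by rewrite (corner_surj f_m) // PsiK.
- by rewrite !(HE, hE) !PhiK -!cornerD // addnC.
- by rewrite HE pn // (negPf no) PsiK.
- by rewrite hE lP.
by rewrite hE PhiK fixx.
Qed.

Lemma q_shom_matrix x i : shom_central f x i ->
  exists2 c, central c & q (shom f_m x i) = b c.
Proof.
move=> xC; have [x0|x0] := eqVneq (x j) 0.
  by exists 0; [apply: central0 | rewrite q_shom0 // linear0].
have [c cC cE] := norm_square xC x0.
have /eqP := q_shom_norm xC; rewrite cE base_charM // -expr2 eqf_sqr.
case/orP=> /eqP ->; first by exists c.
by exists (- c); [apply: centralN | rewrite linearN].
Qed.

End MatrixCase.

Section RationalCenter.
Hypothesis centerQ : forall c : E, central c -> exists a : rat, c = a *: 1.

Lemma base_charQ c : central c -> exists a : rat, b c = a *: 1.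
Proof. by move=> /centerQ[a ->]; exists a; rewrite linearZ /= base_char1. Qed.

Lemma q_central_quadratic : exists2 w : A, central w &
  forall z, central z -> exists a a' : rat, q z = a *: 1 + a' *: q w.
Proof.
pose P n := (0 < n)%N /\ exists2 x : R, shom_central f x n & x j != 0.
have [|n [n0 [x xC x0]] nmin] := @least_nat P.
  (* The element 1 is read as u^(m.+1), in positive degree, so that one can divide by the least
     degree. *)
  exists m.+1; split=> //; exists 1; last by rewrite ffunE oner_neq0.
  by split=> [r|]; rewrite ?rmorph1 // f_m mul1r mulr1.
set w := shom f_m x n; have wC : central w by apply: shom_centralP.
exists w => //.
have qw0 : q w != 0 by apply: q_shom_neq0.
have [om omE] : exists a : rat, q w ^+ 2 = a *: 1.
  by rewrite (q_shom_norm xC); apply/base_charQ/(shom_central_norm star_pos f_star j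
    xC).
have om0 : om != 0.
  apply: contraNneq qw0 => o0; move: omE; rewrite o0 scale0r => /eqP.
  by rewrite sqrf_eq0.
have swC : central (st w) by apply: (star_central_skew star_pos f_star).
suff H y i : shom_central f y i ->
    exists a a' : rat, q (shom f_m y i) = a *: 1 + a' *: q w.
  move=> z zC; rewrite [z]shom_sum linear_sum.
  apply: (big_ind (fun v => exists a a' : rat, v = a *: 1 + a' *: q w)).
  - by exists 0, 0; rewrite !scale0r addr0.
  - move=> _ _ [a [a' ->]] [c [c' ->]]; exists (a + c), (a' + c').
    by rewrite !scalerDl addrACA.
  by move=> i _; apply: H; apply: central_coord.
move=> yC; have [y0|y0] := eqVneq (y j) 0.
  by exists 0, 0; rewrite q_shom0 // !scale0r addr0.
set t := (i %/ n)%N; set r := (i %% n)%N.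
have hC : central (shom f_m y i) by apply: shom_centralP.
have gC : central (shom f_m y i * st w ^+ t) by apply/centralM/centralX.
(* [st w] has degree -n modulo m.+1, so t factors of it bring i = t n + r down to r. The image in M
   stays nonzero because q (st w) = q w. *)
have [y' gE] : exists y', shom f_m y i * st w ^+ t = shom f_m y' r.
  rewrite /w (skew_star_shom star_pos f_star).
  have [u ->] := shomX f_m (iter (m * n) f (powmap star x)) (m * n) t.
  exists (y * iter i f u); rewrite shomM.
  have -> : (i + m * n * t = r + m.+1 * (t * n))%N.
    rewrite {1}(divn_eq i n) -/t -/r mulSn -[(m * n * t)%N]mulnA [(n * t)%N]mulnC.
    by rewrite -addnA addnCA.
  by rewrite shom_mod.
have y'C : shom_central f y' r by apply: (@central_shom _ _ _ _ f_m); rewrite -gE.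
have qg : q (shom f_m y' r) = q (shom f_m y i) * q w ^+ t.
  rewrite -gE q_mul; first by rewrite q_centralX // qst.
    exact: bicomm_central.
  exact/bicomm_central/centralX.
have y'0 : y' j != 0.
  apply: contraTneq (mulf_neq0 (q_shom_neq0 yC y0) (expf_neq0 t qw0)) => y'0.
  by rewrite -qg q_shom0 // eqxx.
have r0 : r = 0%N.
  case: (posnP r) => // r0; exfalso; apply: (nmin r); first by rewrite ltn_mod.
  by split=> //; exists y'.
have [a aE] : exists a : rat, q (shom f_m y i) * q w ^+ t = a *: 1.
  rewrite -qg r0 shom_C.
  have y'c : central y' by move=> s; have := y'C.1 s; rewrite r0.
  by rewrite q_base //; apply/base_charQ/coord_central.
have wt : q w ^+ t * q w ^+ t = om ^+ t *: 1.
  by rewrite -exprMn -expr2 omE exprZn expr1n.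
have wt' : q w ^+ t = om ^+ t./2 *: q w ^+ odd t.
  rewrite -{1}[t]odd_double_half addnC exprD -muln2 mulnC exprM omE exprZn expr1n.
  by rewrite -scalerAl mul1r.
(* From q(y u^i) (q w)^t = a and (q w)^2 = om: q(y u^i) = a om^(-t) (q w)^t, where only the parity
   of t matters up to a rational factor. *)
have qy : q (shom f_m y i) = (a / om ^+ t * om ^+ t./2) *: q w ^+ odd t.
  rewrite -scalerA -wt'.
  have -> : q (shom f_m y i) = (om ^+ t)^-1 *: (q (shom f_m y i) * q w ^+ t * q w ^+
    t).
    by rewrite -mulrA wt -scalerAr mulr1 scalerA mulVf ?scale1r // expf_neq0.
  by rewrite aE -scalerAl mul1r scalerA mulrC.
case: (odd t) qy => ->; first by exists 0, (a / om ^+ t * om ^+ t./2);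
  rewrite scale0r add0r.
by exists (a / om ^+ t * om ^+ t./2), 0; rewrite scale0r addr0.
Qed.

End RationalCenter.

End Character.

(** * Splitting, and the theorem *)

Lemma rmorphZ_rat (A B : lalgType rat) (g : {rmorphism A -> B}) a x :
  g (a *: x) = a *: g x.
Proof.
have d0 : (denq a)%:~R != 0 :> rat by rewrite intr_eq0 denq_eq0.
apply: (scalerI d0); rewrite scaler_int -raddfMz -scaler_int !scalerA.
by rewrite mulrC -numqE !scaler_int raddfMz.
Qed.

Lemma bij_rmorph_inv (A B : pzRingType) (g : {rmorphism A -> B}) :
  bijective g -> exists h : {rmorphism B -> A}, cancel g h /\ cancel h g.
Proof.
case=> h gK hK.
have ha : {morph h : x y / x - y}.
  by move=> x y; rewrite -[x in LHS]hK -[y in LHS]hK -rmorphB gK.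
have hm : monoid_morphism h.
  split=> [|x y]; first by rewrite -(rmorph1 g) gK.
  by rewrite -[x in LHS]hK -[y in LHS]hK -rmorphM gK.
by exists (HB.pack_for {rmorphism B -> A} h
  (GRing.isZmodMorphism.Build _ _ h ha) (GRing.isMonoidMorphism.Build _ _ h hm)).
Qed.

Lemma is_matrix_algP (E : falgType rat) (L : fieldType) : is_matrix_alg E L ->
  exists d (Phi : {rmorphism E -> 'M[L]_d.+1}) (Psi : {rmorphism 'M[L]_d.+1 -> E}),
    cancel Phi Psi /\ cancel Psi Phi.
Proof.
case=> [[|d] [Phi /bij_rmorph_inv[Psi [PhiK PsiK]]]]; last by exists d, Phi, Psi.
have /eqP : (1 : E) = 0 by apply: (can_inj PhiK); apply/matrixP=> [[]].
by rewrite oner_eq0.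
Qed.

(** * Splitting of the simple factors when E is a rational matrix algebra *)

Section Split.
Variables (E : falgType rat) (simpleE : simple_alg E).
Variables (m k : nat) (f : {lrmorphism power E k.+1 -> power E k.+1}).
Hypothesis f_m : iter m.+1 f =1 id.
Notation R := (power E k.+1).
Notation A := (skew_alg f_m).
Notation C := (@skewC _ _ m f f_m).
Variables (d : nat).
Variables (Phi : {rmorphism E -> 'M[rat]_d.+1}) (Psi : {rmorphism 'M[rat]_d.+1 ->
  E}).
Hypotheses (PhiK : cancel Phi Psi) (PsiK : cancel Psi Phi).
Hypothesis PsiZ : forall a X, Psi (a *: X) = a *: Psi X.

Definition rank1 : E := Psi (delta_mx 0 0).

Lemma rank1_idem : rank1 * rank1 = rank1.
Proof. by rewrite -rmorphM -mulmxE mul_delta_mx. Qed.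

Lemma rank1_corner r : exists a : rat, rank1 * r * rank1 = a *: rank1.
Proof.
exists (Phi r 0 0); rewrite -[r in LHS]PhiK -!rmorphM -PsiZ; congr (Psi _).
apply/matrixP=> i l; rewrite !mxE (bigD1 0) //= big1 ?addr0 => [|t /negPf t0].
  rewrite !mxE (bigD1 0) //= big1 ?addr0 => [|t /negPf t0].
    rewrite !mxE !eqxx !andbT /=; case: (i == 0); case: (l == 0);
      by rewrite !(mul0r, mul1r, mulr0, mulr1).
  by rewrite mxE t0 andbF mul0r.
by rewrite !mxE t0 mulr0.
Qed.

Lemma rank1_full : exists (n : nat) (a c : 'I_n -> E), \sum_i a i * rank1 * c i = 1.
Proof.
exists d.+1, (fun i => Psi (delta_mx i 0)), (fun i => Psi (delta_mx 0 i)).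
under eq_bigr => i _ do rewrite -!rmorphM -!mulmxE !mul_delta_mx.
rewrite -rmorph_sum -[RHS](rmorph1 Psi); congr (Psi _).
apply/matrixP=> i l; rewrite summxE !mxE (bigD1 i) //= big1 ?addr0.
  by rewrite mxE eqxx eq_sym.
by move=> t /negPf ti; rewrite mxE eq_sym ti.
Qed.

Section AtCoord.
Variable j : 'I_k.+1.
Notation corner := (corner f j).

(* The stabiliser of j is generated by its least positive element n, and
   corner n is conjugation by some y; powers of y are then fixed by the
   whole stabiliser. *)
Lemma stab_conj : exists y' : nat -> E,
  forall i, stab f j i -> [/\ forall r, y' i * corner i r = r * y' i,
    forall r, exists r', r = r' * y' i & forall l, stab f j l -> corner l (y' i) =
      y' i].
Proof.
have [|n [n0 nS] nmin] := @least_nat (fun n => (0 < n)%N /\ stab f j n).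
  by exists m.+1; split=> //; rewrite /stab -[m.+1]muln1 (corner_mulS f_m).
have ndvd i : stab f j i -> (n %| i)%N.
  move=> iS; rewrite /dvdn; case: (posnP (i %% n)%N) => [/eqP //|r0]; exfalso.
  apply: (nmin (i %% n)%N); first by rewrite ltn_mod.
  split=> //; apply: (stabB simpleE f_m (stabM (i %/ n)%N nS)).
  by rewrite mulnC -divn_eq.
have [H HE] := corner_matrix Phi Psi nS.
have HZ c : H c%:M = c%:M.
  rewrite HE -scalemx1 PsiZ linearZ /= [Psi 1%:M]rmorph1.
  have -> : c *: corner n 1 = Psi (c%:M) by rewrite nS -scalemx1 PsiZ [Psi
    1%:M]rmorph1.
  by rewrite PsiK scalemx1.
have [P Pu PE] := skolem_noether HZ.
pose y := Psi P; pose yi := Psi P^-1.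
have yyi : y * yi = 1 by rewrite -rmorphM mulrV // rmorph1.
have yiy : yi * y = 1 by rewrite -rmorphM mulVr // rmorph1.
have yE r : corner n r * y = y * r.
  have := PE (Phi r); rewrite HE PhiK => /(congr1 Psi).
  by rewrite !rmorphM !PhiK.
have cy : corner n yi = yi.
  have : corner n y = y by rewrite -[LHS]mulr1 -yyi mulrA yE -mulrA yyi mulr1.
  move=> cy; have : corner n yi * corner n y = 1 by rewrite -cornerM yiy.
  by rewrite cy => /(congr1 (fun t => t * yi)); rewrite -mulrA yyi mulr1 mul1r.
have cX t : corner n (yi ^+ t) = yi ^+ t.
  by elim: t => [|t IH]; rewrite ?expr0 // exprS cornerM cy IH.
have cornX l t : stab f j l -> corner l (yi ^+ t) = yi ^+ t.
  move=> /ndvd/dvdnP[s ->]; rewrite mulnC; elim: s => [|s IH];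
    first by rewrite muln0 corner_id.
  by rewrite mulnS cornerD // IH.
exists (fun i => yi ^+ (i %/ n)%N) => i iS; split=> [r|r|l lS]; last exact: cornX.
  have /dvdnP[t it] := ndvd i iS; rewrite it mulnK //.
  elim: t {it} r => [|t IH] r; first by rewrite mul0n corner_id expr0 mul1r mulr1.
  rewrite mulSn cornerD // exprSr -mulrA.
  have E' s : yi * corner n s = s * yi.
    by rewrite -[LHS]mulr1 -yyi !mulrA -[yi * _ * y]mulrA yE mulrA yiy mul1r.
  by rewrite E' mulrA IH mulrA.
exists (r * y ^+ (i %/ n)); rewrite -mulrA.
suff -> : y ^+ (i %/ n) * yi ^+ (i %/ n) = 1 by rewrite mulr1.
by rewrite -exprMn_comm ?yyi ?expr1n // /GRing.comm yyi yiy.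
Qed.

(** In degree i the product vanishes unless f^i fixes the j-th copy. If it does, writing a_ij = r' v
    with v corner(r) = r v moves the right-hand idempotent past v, leaving a rational multiple of
    rank1 v; the translates of v under f add up to a central element. *)
Lemma rank1_skew (a : A) : exists2 z : A, central z &
  C (incl j rank1) * a * C (incl j rank1) = z * C (incl j rank1).
Proof.
have [y' y'P] := stab_conj.
rewrite [a]shom_sum mulr_sumr mulr_suml.
apply: (big_ind (fun v => exists2 z : A, central z & v = z * C (incl j rank1))).
- by exists 0; [apply: central0 | rewrite mul0r].
- move=> _ _ [z zC ->] [t tC ->]; exists (z + t);
  [exact: centralD | by rewrite mulrDl].
move=> i _; rewrite -!shom_C !shomM add0n addn0 [iter 0 f _]/=.
have mulE (x : R) : incl j rank1 * x * iter i f (incl j rank1) =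
    incl j (rank1 * x j * corner i rank1).
  by rewrite incl_mull incl_mull.
rewrite mulE.
case: (corner1_cases simpleE f_m j i) => iS.
  exists 0; first exact: central0.
  have -> : corner i rank1 = 0 by rewrite -[rank1]mul1r cornerM iS mul0r.
  by rewrite mulr0 linear0 shom0 mul0r.
have [yc yr yfix] := y'P i iS.
pose v := y' i.
have [r' r'E] := yr (a i j).
have [al alE] := rank1_corner r'.
have -> : rank1 * a i j * corner i rank1 = al *: (rank1 * v).
  by rewrite r'E -!mulrA yc mulrA mulrA alE scalerAl.
pose x : R := \sum_(t < m.+1) iter t f (incl j v).
have xC : shom_central f x i.
  split=> [r|]; last first.
    rewrite /x linear_sum big_ord_recr [RHS]big_ord_recl /= addrC; congr (_ + _).
    exact: f_m.
  rewrite /x mulr_suml mulr_sumr; apply: eq_bigr => t _.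
  rewrite -[r](iter_surj f_m t) -iterD addnC iterD -!iterf_mul; congr iter.
  by rewrite incl_mull incl_mulr stab_iter // yc.
(* Each exponent t fixing the j-th copy contributes v to the j-th coordinate and the others
   contribute 0; t = 0 ensures that N is nonzero. *)
pose N := (\sum_(t < m.+1) (corner t 1%R == 1%R))%N.
have xj : x j = N%:R *: v.
  rewrite /x sum_ffunE /N natr_sum scaler_suml; apply: eq_bigr => t _.
  case: eqP => [tS|tS]; first by rewrite scale1r; apply: yfix.
  case: (corner1_cases simpleE f_m j t) => // t0.
  by rewrite scale0r -[v]mul1r -/(corner t _) cornerM t0 mul0r.
have N0 : N%:R != 0 :> rat.
  by rewrite pnatr_eq0 /N big_ord_recl /= corner_id eqxx.
have hC : central (shom f_m x i) by apply: shom_centralP.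
exists ((al / N%:R) *: shom f_m x i).
  by move=> z; rewrite -scalerAl -scalerAr hC.
rewrite -scalerAl hC shomM /= add0n incl_mull xj -scalerAr /shom.
have inclZ c w : incl j (c *: w) = c *: incl j w by exact: linearZ.
by rewrite !inclZ !skewCZ -!scalerAl scalerA divfK.
Qed.

End AtCoord.

Lemma skew_split (B : {aspace A}) : simple_factor B -> matrix_alg_over_center
  (subvs_of B).
Proof.
case=> /is_idealP idB simB; set e := algid B.
have eB : e \in B := memv_algid B.
have eC : central e.
  move=> a; have [aB Ba] := idB a e eB.
  by rewrite -[a * e](algidl aB) -[e * a](algidr Ba) mulrA.
have [j je] : exists j, C (incl j 1) * e != 0.
  apply: NNPP => no; have := algid_neq0 B; rewrite -/e -[e]mul1r.
  rewrite -(sum_incl1 f_m).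
  rewrite mulr_suml big1 ?eqxx // => j _.
  by apply/eqP/contraT => h; case: no; exists j.
pose p0 := C (incl j rank1).
have pB : p0 * e \in B by case: (idB p0 e eB).
have pp0 : p0 * p0 = p0 by rewrite -skewCM -inclM rank1_idem.
apply: (@matrix_alg_criterion _ (subvs_of B) (Subvs pB)) => //.
- apply: contraNneq je => /(congr1 val) /= p0e.
  have [n [a [c acE]]] := rank1_full.
  rewrite -acE linear_sum linear_sum mulr_suml big1 // => i _.
  by rewrite /= !inclM !skewCM -mulrA -eC mulrA -[C _ * C _ * e]mulrA p0e mulr0
    mul0r.
- apply: val_inj; rewrite /= -mulrA [e * _]mulrA eC -!mulrA.
  by rewrite (algidl eB) mulrA pp0.
move=> b; have [z zC zE] := rank1_skew j (vsval b).
have zB : z * e \in B by case: (idB z e eB).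
exists (Subvs zB).
  by move=> a; apply: val_inj; apply: (centralM zC eC).
have pe x y : x * e * (y * e) = x * y * e.
  by rewrite -mulrA eC -!mulrA (algidl eB).
suff key : p0 * e * vsval b * (p0 * e) = z * e * (p0 * e) by apply: val_inj.
rewrite [RHS]pe -[p0 * e * _]mulrA eC [p0 * (_ * e)]mulrA pe.
by rewrite -zE.
Qed.

End Split.

(** * From characters to the fields named in the theorem *)

Section Assembly.
Variables (E : falgType rat) (simpleE : simple_alg E).
Variables (star : {linear E -> E}) (star_pos : positive_involution star).
Variables (m k : nat) (f : {lrmorphism power E k.+1 -> power E k.+1}).
Hypothesis f_star : forall x, f (powmap star x) = powmap star (f x).
Hypothesis f_m : iter m.+1 f =1 id.
Variables (K : fieldExtType rat) (ZE_K : {rmorphism center_alg E -> K}).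
Notation A := (skew_alg f_m).
Notation C := (@skewC _ _ m f f_m).
Notation st := (@skew_star E star m k f f_m).
Notation posT := (@skew_pos_trace E star star_pos m k f f_star f_m).

(* Every factor L of the center is CM, or fixed by the involution and then
   jointly embedded with the center of E into a field. *)
Lemma center_factors (P : fieldExtType rat -> Prop) :
  (forall L, CM_field L -> P L) ->
  (forall (L M : fieldExtType rat) (al : {rmorphism L -> M}) (q : {linear A -> M})
      (pi : center_alg A -> L) j,
     field_char q j -> (forall z, central z -> q (st z) = q z) ->
     (forall y, exists z, y = pi z) -> (forall z, al (pi z) = q (vsval z)) -> P L) ->
  product_of_fields P (center_alg A).
Proof.
move=> PCM PL.
have stZ x : x \in 'Z({:A})%AS -> st x \in 'Z({:A})%AS.
  by move=> /mem_center xC; apply/mem_center;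
    apply: (star_central_skew star_pos f_star).
have posZ := sub_pos_trace posT stZ.
have comZ : commutative (@GRing.mul (center_alg A)).
  by move=> x y; apply: val_inj; have /mem_center := subvsP x; apply.
have [n [L [pi [io [ioK pi_io sum_io]]]]] := comm_pos_fields posZ comZ.
apply: (factors_of_product ioK pi_io sum_io) => i.
have [s [sK sE [TL [TLs TLp]]]] := factor_involution posZ comZ ioK pi_io sum_io i.
case: (totally_real_or_CM sK TLs TLp) => [striv|]; last exact: PCM.
pose e : A := vsval (io i 1).
have eC : central e by apply/mem_center/subvsP.
have ioM := factor_ioM ioK pi_io sum_io.
have ee : e * e = e by have := ioM i 1 1; rewrite mulr1 => /(congr1 val).
have e0 : e != 0.
  apply/eqP=> e0; have : io i 1 = 0 by apply: val_inj.
  by move/(congr1 (pi i)); rewrite ioK linear0 => /eqP; rewrite oner_eq0.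
have [M [q [j [qP qe]]]] := field_char_exists star_pos f_star eC ee e0.
have zW (z : center_alg A) : vsval z \in bicomm f_m.
  by apply/bicomm_central/mem_center/subvsP.
(* The map q restricted to the factor L; it is unital because M was chosen with q e = 1. *)
pose al y := q (vsval (io i y)).
have ala : {morph al : x y / x - y} by move=> x y; rewrite /al !linearB.
have alm : monoid_morphism al.
  split=> [|x y]; first exact: qe.
  by rewrite /al ioM; case: qP => _ qM _; apply: qM (zW _) (zW _).
pose alM : {rmorphism L i -> M} := HB.pack al
  (GRing.isZmodMorphism.Build _ _ al ala) (GRing.isMonoidMorphism.Build _ _ al alm).
have alE z : alM (pi i z) = q (vsval z).
  rewrite /= /al (factor_io_pi ioK pi_io sum_io) /=; case: qP => _ qM _.
  by apply: etrans (qM _ _ (zW z) (zW (io i 1))) _; rewrite [X in _ * X]qe mulr1.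
apply: (PL (L i) M alM q (pi i) j) => //.
  move=> z zC; pose z' : center_alg A := Subvs (introT (mem_center z) zC).
  have -> : z = vsval z' by [].
  have stE := sub_stE stZ z'.
  by rewrite -stE -!alE sE striv.
by move=> y; exists (io i y); rewrite ioK.
Qed.

(** The image of L in M lies in that of the center of E, which embeds by [base_char]; inverting this
    embedding maps L into the center of E, hence into K. *)
Lemma subfield_of_char (L M : fieldExtType rat) (al : {rmorphism L -> M})
    (q : {linear A -> M}) (pi : center_alg A -> L) j :
  field_char q j -> (forall y, exists z, y = pi z) ->
  (forall z, al (pi z) = q (vsval z)) ->
  (forall z, central z -> exists2 c, central c & q z = base_char q j c) ->
  subfield_of K L.
Proof.
move=> qP piS alE qB.
have yP y : exists c : center_alg E, al y == base_char q j (vsval c).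
  have [z ->] := piS y; have /mem_center zC := subvsP z.
  have [c cC cE] := qB _ zC; exists (Subvs (introT (mem_center c) cC)).
  by rewrite alE cE.
pose g y := xchoose (yP y).
have gE y : base_char q j (vsval (g y)) = al y by rewrite (eqP (xchooseP (yP y))).
have cC (c : center_alg E) : central (vsval c) by apply/mem_center/subvsP.
have inj (c c' : center_alg E) :
    base_char q j (vsval c) = base_char q j (vsval c') -> c = c'.
  by move/(base_char_inj simpleE qP (cC _) (cC _))/val_inj.
have ga : {morph g : x y / x - y}.
  move=> x y; apply: inj; rewrite gE rmorphB -!gE.
  have -> : vsval (g x - g y) = vsval (g x) - vsval (g y) by rewrite linearB.
  by rewrite /base_char !linearB.
have gm : monoid_morphism g.
  split=> [|x y]; apply: inj; rewrite gE.
    by rewrite vsval1 ?(base_char1 qP) ?rmorph1 //; apply/mem_center/central1.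
  by rewrite rmorphM /= (base_charM qP) // !gE.
pose gM : {rmorphism L -> center_alg E} := HB.pack g
  (GRing.isZmodMorphism.Build _ _ g ga) (GRing.isMonoidMorphism.Build _ _ g gm).
by exists (ZE_K \o gM).
Qed.


(** If star fixed the scalars, y -> trace of left multiplication by y on E would be positive on
    nonzero squares of K, so every embedding of K would be real, contradicting total imaginarity. *)
Lemma star_center_nontrivial : CM_field K -> is_matrix_alg E K ->
  exists2 c : E, central c & star c <> c.
Proof.
case=> Kim _ /is_matrix_algP[d [Phi [Psi [PhiK PsiK]]]].
apply: NNPP => no.
have striv c : central c -> star c = c.
  by move=> cC; apply: NNPP => h; apply: no; exists c.
pose ka (y : K) := Psi y%:M.
have kaC y : central (ka y) by apply: (Psi_scalar_central PhiK).
have kaD x y : ka (x - y) = ka x - ka y by rewrite /ka raddfB rmorphB.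
have kaM x y : ka (x * y) = ka x * ka y by rewrite /ka scalar_mxM mulmxE rmorphM.
have ka1 : ka 1 = 1 by rewrite /ka; apply: rmorph1.
have kam : monoid_morphism ka by split.
pose kaR : {rmorphism K -> E} := HB.pack ka
  (GRing.isZmodMorphism.Build _ _ ka kaD) (GRing.isMonoidMorphism.Build _ _ ka kam).
have tl : scalar (@alg_trace rat E \o ka).
  move=> a x y /=.
  have -> : ka (a *: x + y) = a *: ka x + ka y.
    by rewrite -[ka (_ + _)]/(kaR _) rmorphD rmorphZ_rat.
  by rewrite linearP.
pose TK : {scalar K} := HB.pack (@alg_trace rat E \o ka)
  (GRing.isLinear.Build _ _ _ _ (@alg_trace rat E \o ka) tl).
have [tau _] := numfield_embeds K.
have [x /negP] := Kim tau; apply.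
apply/CrealP/esym; apply: (@positive_conj K idfun TK) => // y y0.
case: star_pos => _ _ /(_ (ka y)); rewrite /= kaM striv; last exact: kaC.
by apply; apply: contraNneq y0 => h; rewrite -(fmorph_eq0 kaR) /= h.
Qed.

End Assembly.

Theorem mainTheorem9
  (E : falgType rat) (simpleE : simple_alg E)
  (star : {linear E -> E}) (star_pos : positive_involution star)
  (m k : nat)
  (f : {lrmorphism power E k.+1 -> power E k.+1})
  (f_star : forall x, f (powmap star x) = powmap star (f x))
  (f_m : iter m.+1 f =1 id)
  (K : fieldExtType rat) (K_CM : CM_field K)
  (ZE_K : {rmorphism center_alg E -> K})
  (cases : odd m.+1 \/ is_matrix_alg E K \/ is_matrix_alg E rat) :
  (odd m.+1 \/ is_matrix_alg E K ->
     product_of_fields (fun L => CM_field L \/ subfield_of K L)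
       (center_alg (skew_alg f_m)))
  /\
  (is_matrix_alg E rat ->
     product_of_fields
       (fun L => CM_field L \/ subfield_of K L \/ quadratic_field L)
       (center_alg (skew_alg f_m))
     /\ product_of_simple_factors (skew_alg f_m)
     /\ (forall B : {aspace skew_alg f_m}, simple_factor B ->
           matrix_alg_over_center (subvs_of B))).
Proof.
split=> [cs|EQ].
  apply: (center_factors star_pos f_star) => [L|L M al q pi j qP qst piS alE].
    by left.
  right; apply: (subfield_of_char simpleE ZE_K qP piS alE).
  apply: q_central_mem => // x i xC.
  case: cs => [mo|EK]; first exact: (q_shom_odd simpleE star_pos f_star qP qst xC
    mo).
  have nt := star_center_nontrivial star_pos K_CM EK.
  have [d [Phi [Psi [PhiK PsiK]]]] := is_matrix_algP EK.
  exact: (q_shom_matrix simpleE star_pos f_star qP qst PhiK PsiK nt xC).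
have [d [Phi [Psi [PhiK PsiK]]]] := is_matrix_algP EQ.
have PsiZ a X : Psi (a *: X) = a *: Psi X by apply: rmorphZ_rat.
split; last first.
  split; first exact: (pos_trace_product (skew_pos_trace star_pos f_star f_m)).
  by move=> B; apply: (skew_split simpleE PhiK PsiK PsiZ).
apply: (center_factors star_pos f_star) => [L|L M al q pi j qP qst piS alE].
  by left.
right.
have centerQ (c : E) : central c -> exists a : rat, c = a *: 1.
  move=> cC; have [a aE] := Phi_central PsiK cC.
  by exists a; rewrite -[c]PhiK aE -scalemx1 PsiZ [Psi 1%:M]rmorph1.
have [w wC wP] := q_central_quadratic simpleE star_pos f_star qP qst centerQ.
(* If q w is rational, L maps into the rational multiples of 1 and embeds in K; otherwise 1 and the
   image of w form a basis of L. *)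
case: (classic (exists a : rat, q w = a *: 1)) => [[a qw]|nw].
  left; apply: (subfield_of_char simpleE ZE_K qP piS alE) => z zC.
  have [a1 [a2 ->]] := wP z zC; exists ((a1 + a2 * a) *: 1).
    by move=> r; rewrite mulr_algl mulr_algr.
  have -> : base_char q j ((a1 + a2 * a) *: 1) = (a1 + a2 * a) *: base_char q j 1.
    by rewrite /base_char !linearZ.
  by rewrite (base_char1 qP) qw scalerA -scalerDl.
right; pose w' : center_alg (skew_alg f_m) := Subvs (introT (mem_center w) wC).
have alZ a y : al (a *: y) = a *: al y by apply: rmorphZ_rat.
have LE y : exists a a' : rat, y = a *: 1 + a' *: pi w'.
  have [z ->] := piS y; have /mem_center zC := subvsP z.
  have [a [a' zE]] := wP _ zC; exists a, a'.
  by apply: (fmorph_inj al); rewrite rmorphD !alZ rmorph1 !alE zE.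
pose X : seq L := [:: 1; pi w'].
have fr : free X.
  rewrite free_cons span_seq1 seq1_free; apply/andP; split.
    apply/negP=> /vlineP[a aE]; have a0 : a != 0.
      by apply: contraTneq (oner_neq0 L) => a0; rewrite aE a0 scale0r eqxx.
    apply: nw; exists a^-1; rewrite -[w]/(vsval w') -alE -[1](rmorph1 al) aE alZ.
    by rewrite scalerA mulVf // scale1r.
  apply/eqP=> w0; apply: nw; exists 0.
  by rewrite -[w]/(vsval w') -alE w0 rmorph0 scale0r.
rewrite /quadratic_field; have -> : fullv = <<X>>%VS.
  apply/esym/eqP; rewrite eqEsubv subvf; apply/subvP=> y _.
  have [a [a' ->]] := LE y.
  by rewrite memvD // memvZ // memv_span // !inE eqxx ?orbT.
by apply/eqP; move: fr; rewrite /free.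
Qed.
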